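(* Assume that $A_{\mathrm{ext}}$ generates a contractive $C_0$-semigroup on $H_1\times H_2$ and that $\sigma(A_{\mathrm{ext}}) \cap \mathrm{i}\mathbb{R} = \emptyset$. Then any of the following assumptions implies that $(e^{tA_S})_{t \ge 0}$ is exponentially stable: (1) The space $\operatorname{dom}(A_{21})$, endowed with the graph norm of $A_{21}$, embeds compactly into $H_1$. (2) The semigroup $(e^{tA_S})_{t \ge 0}$ is eventually norm continuous. (3) The domain of $A_1$ splits as $\operatorname{dom}(A_1) = \operatorname{dom}(A_{11}) \times \operatorname{dom}(A_{12})$ for vector subspaces $\operatorname{dom}(A_{11}) \subseteq H_1$ and $\operatorname{dom}(A_{12}) \subseteq H_2$, so that $A_1 = \begin{pmatrix} A_{11} & A_{12} \end{pmatrix}$ with operators $A_{11}: \operatorname{dom}(A_{11}) \subseteq H_1 \to H_1$ and $A_{12}: \operatorname{dom}(A_{12}) \subseteq H_2 \to H_1$; and there exists $\varepsilon > 0$ such that the set $\operatorname{W}(A_{11}) \cap ([-\varepsilon,0] \times \mathrm{i}\mathbb{R})$ is bounded. (4) One has $H_1 = L^2(\Omega,\mu)$ for a measure space $(\Omega,\mu)$ and the semigroup $(e^{tA_S})_{t \ge 0}$ on $H_1$ is positive in the sense that $0 \le f \in H_1$ implies $e^{tA_S} f \ge 0$ for all $t \ge 0$ (inequalities understood almost everywhere).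
   Context: Inner products on complex Hilbert spaces are linear in the first and antilinear in the second component. Let $H_1, H_2$ be non-zero complex Hilbert spaces, let $A_1: \operatorname{dom}(A_1) \subseteq H_1 \times H_2 \to H_1$ and $A_{21}: \operatorname{dom}(A_{21}) \subseteq H_1 \to H_2$ be linear operators (defined on vector subspaces), and let $S: H_2 \to H_2$ be a bounded linear operator that is coercive: there is $\nu > 0$ with $\operatorname{Re}(h_2 | S h_2)_{H_2} \ge \nu \|h_2\|_{H_2}^2$ for all $h_2 \in H_2$. The operator $A_{\mathrm{ext}}$ on $H_1 \times H_2$ has domain $\operatorname{dom}(A_{\mathrm{ext}}) = \{ (h_1,h_2) \in \operatorname{dom}(A_1) : h_1 \in \operatorname{dom}(A_{21}) \}$ and acts as $A_{\mathrm{ext}}(h_1,h_2) = (A_1(h_1,h_2),\, A_{21}h_1)$. The operator $A_S$ on $H_1$ has domain $\operatorname{dom}(A_S) = \{ h_1 \in \operatorname{dom}(A_{21}) : (h_1, S A_{21} h_1) \in \operatorname{dom}(A_1) \}$ and acts as $A_S h_1 = A_1 (h_1, S A_{21} h_1)$. (Known theorem of Zwart, Le Gorrec and Maschke: if $A_{\mathrm{ext}}$ generates a contractive $C_0$-semigroup on $H_1\times H_2$, then $A_S$ generates a contractive $C_0$-semigroup $(e^{tA_S})_{t\ge 0}$ on $H_1$.) $\sigma(\cdot)$ is the spectrum. A $C_0$-semigroup is exponentially stable if it converges to $0$ with respect to the operator norm as $t \to \infty$; it is eventually norm continuous if there is $t_0 \ge 0$ such that it is continuous in operator norm on $(t_0,\infty)$.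 The graph norm of $A_{21}$ is $\|u\|_{A_{21}}^2 = \|A_{21}u\|_{H_2}^2 + \|u\|_{H_1}^2$. The numerical range of an operator $A$ is $\operatorname{W}(A) = \{ (v|Av) : v \in \operatorname{dom}(A), \|v\| = 1 \}$. The set $[-\varepsilon,0]\times \mathrm{i}\mathbb{R}$ is the strip $\{\lambda \in \mathbb{C} : -\varepsilon \le \operatorname{Re}\lambda \le 0\}$. $L^2(\Omega,\mu)$ is the space of complex-valued square-integrable functions. *)

(* Defs.v *)
From HB Require Import structures.
From mathcomp Require Import all_boot all_order all_algebra.
From mathcomp Require Import complex ring.
From mathcomp Require Import all_classical all_reals all_analysis.
Set Implicit Arguments.
Unset Strict Implicit.
Unset Printing Implicit Defensive.
Import Order.TTheory GRing.Theory Num.Theory.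
Import numFieldNormedType.Exports.
Local Open Scope classical_set_scope.
Local Open Scope ring_scope.

(* The norm of a [normedModType R[i]] takes its values in [R[i]]. *)
HB.mixin Record isHilbert (R : realType) H & CompleteNormedModule R[i] H := {
  hdot : {dot H for @Num.conj R[i]} ;
  hdot_norm : forall x : H, hdot x x = `|x| ^+ 2
}.

#[short(type="hilbertType")]
HB.structure Definition Hilbert (R : realType) :=
  {H of CompleteNormedModule R[i] H & isHilbert R H}.

Notation "''[' u , v ]" := (hdot u%R v%R) : ring_scope.

(* The library's [U * V] carries the maximum norm, hence the alias. *)
Definition hprod (U V : Type) : Type := (U * V)%type.

Section HProdNorm.
Context (R : realType) (U V : hilbertType R).
Notation P := (hprod U V).
HB.instance Definition _ := GRing.Lmodule.copy P (U * V)%type.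

Definition hprod_norm (x : P) : R[i] := sqrtC (`|x.1| ^+ 2 + `|x.2| ^+ 2).

Lemma hprod_sum_ge0 (x : P) : 0 <= `|x.1| ^+ 2 + `|x.2| ^+ 2.
Proof. by rewrite addr_ge0 ?exprn_ge0. Qed.

Lemma hprod_normD (x y : P) :
  hprod_norm (x + y) <= hprod_norm x + hprod_norm y.
Proof.
have sq0 (z : P) : 0 <= hprod_norm z by rewrite sqrtC_ge0 hprod_sum_ge0.
rewrite -ler_sqr ?nnegrE ?addr_ge0// sqrrD !sqrtCK.
set a := `|x.1|; set b := `|x.2|; set c := `|y.1|; set d := `|y.2|.
have [a0 b0 c0 d0] : [/\ 0 <= a, 0 <= b, 0 <= c & 0 <= d] by split; exact: normr_ge0.
have le1 : `|(x + y).1| ^+ 2 + `|(x + y).2| ^+ 2 <= (a + c) ^+ 2 + (b + d) ^+ 2.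
  by apply: lerD; rewrite ler_sqr ?nnegrE ?addr_ge0// ler_normD.
have le2 : a * c + b * d <= hprod_norm x * hprod_norm y.
  rewrite -ler_sqr ?nnegrE ?addr_ge0 ?mulr_ge0// exprMn !sqrtCK -/a -/b -/c -/d.
  rewrite -subr_ge0 (_ : _ - _ = (a * d - b * c) ^+ 2); last by ring.
  rewrite real_exprn_even_ge0// rpredB ?rpredM ?ger0_real//.
apply: le_trans le1 _.
have -> : (a + c) ^+ 2 + (b + d) ^+ 2 =
    a ^+ 2 + b ^+ 2 + (a * c + b * d) *+ 2 + (c ^+ 2 + d ^+ 2) by ring.
by rewrite lerD2r lerD2l lerMn2r.
Qed.

Lemma hprod_normZ (l : R[i]) (x : P) : hprod_norm (l *: x) = `|l| * hprod_norm x.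
Proof.
rewrite /hprod_norm /= !normrZ !exprMn -mulrDr sqrtCM ?nnegrE ?exprn_ge0//.
by rewrite exprCK.
Qed.

Lemma hprod_norm_eq0 (x : P) : hprod_norm x = 0 -> x = 0.
Proof.
move/eqP; rewrite sqrtC_eq0 paddr_eq0 ?exprn_ge0// !sqrf_eq0 !normr_eq0.
by case: x => x1 x2 /= /andP[/eqP-> /eqP->].
Qed.

HB.instance Definition _ :=
  Lmodule_isNormed.Build R[i] P hprod_normD hprod_normZ hprod_norm_eq0.

Lemma hprod_fst_le (x : P) : `|x.1| <= `|x|.
Proof.
rewrite -ler_sqr ?nnegrE// [`|x|]/(hprod_norm x) sqrtCK.
by rewrite lerDl exprn_ge0.
Qed.

Lemma hprod_snd_le (x : P) : `|x.2| <= `|x|.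
Proof.
rewrite -ler_sqr ?nnegrE// [`|x|]/(hprod_norm x) sqrtCK.
by rewrite lerDr exprn_ge0.
Qed.

Lemma hprod_norm_le (x : P) : `|x| <= `|x.1| + `|x.2|.
Proof.
rewrite -ler_sqr ?nnegrE ?addr_ge0// [`|x|]/(hprod_norm x) sqrtCK sqrrD.
by rewrite addrAC lerDl mulrn_wge0 ?mulr_ge0.
Qed.

Lemma hprod_complete (F : set_system P) : ProperFilter F -> cauchy F -> cvg F.
Proof.
move=> FF /cauchy_ballP Fc.
have c1 : cauchy (fst @ F).
  apply/cauchy_ballP => e e0; have [[A B] /= [FA FB] AB] := Fc e e0.
  exists (fst @` A, fst @` B) => /=.
    by split; [apply: filterS FA|apply: filterS FB] => x ?; exists x.
  move=> -[_ _] /= [[x Ax <-] [y By <-]].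
  have := AB (x, y) (conj Ax By); rewrite -!ball_normE /=.
  by apply: le_lt_trans; have := hprod_fst_le (x - y).
have c2 : cauchy (snd @ F).
  apply/cauchy_ballP => e e0; have [[A B] /= [FA FB] AB] := Fc e e0.
  exists (snd @` A, snd @` B) => /=.
    by split; [apply: filterS FA|apply: filterS FB] => x ?; exists x.
  move=> -[_ _] /= [[x Ax <-] [y By <-]].
  have := AB (x, y) (conj Ax By); rewrite -!ball_normE /=.
  by apply: le_lt_trans; have := hprod_snd_le (x - y).
move: c1 c2 => /cauchy_cvg/cvg_ex[/= l1 l1P] /cauchy_cvg/cvg_ex[/= l2 l2P].
apply/cvg_ex; exists (l1, l2); apply/cvgrPdist_lt => e e0.
have e20 : 0 < e / 2 by rewrite divr_gt0.
move/cvgrPdist_lt : l1P => /(_ _ e20); rewrite near_simpl => l1P.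
move/cvgrPdist_lt : l2P => /(_ _ e20); rewrite near_simpl => l2P.
near=> x; apply: le_lt_trans (hprod_norm_le _) _.
by rewrite (splitr e) ltrD//; near: x.
Unshelve. all: by end_near. Qed.

HB.instance Definition _ := Uniform_isComplete.Build P hprod_complete.

Definition hprod_dot (x y : P) : R[i] := '[x.1, y.1] + '[x.2, y.2].

Lemma hprod_dotDl y : zmod_morphism (hprod_dot^~ y).
Proof. by move=> x z; rewrite /hprod_dot !linearBl opprD addrACA. Qed.

Lemma hprod_dotDr x : zmod_morphism (hprod_dot x).
Proof. by move=> y z; rewrite /hprod_dot !linearBr opprD addrACA. Qed.

Lemma hprod_dotZl y : scalable_for *%R (hprod_dot^~ y).
Proof. by move=> a x; rewrite /hprod_dot !linearZl_LR mulrDr. Qed.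

Lemma hprod_dotZr x : scalable_for (@Num.conj R[i] \; *%R) (hprod_dot x).
Proof. by move=> a y; rewrite /hprod_dot !linearZr_LR /= mulrDr. Qed.

HB.instance Definition _ := isBilinear.Build R[i] P P R[i] *%R
  (@Num.conj R[i] \; *%R) hprod_dot
  hprod_dotDl hprod_dotDr hprod_dotZl hprod_dotZr.

Lemma hprod_dotC (x y : P) :
  hprod_dot x y = (-1) ^+ false * Num.conj (hprod_dot y x).
Proof. by rewrite mul1r rmorphD /= /hprod_dot; congr +%R; rewrite hermC mul1r. Qed.

HB.instance Definition _ := isHermitianSesquilinear.Build R[i] P false
  (@Num.conj R[i]) hprod_dot hprod_dotC.

Lemma hprod_dot_norm (x : P) : hprod_dot x x = `|x| ^+ 2.
Proof. by rewrite [`|x|]/(hprod_norm x) sqrtCK /hprod_dot !hdot_norm. Qed.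

Lemma hprod_dot_gt0 (x : P) : x != 0 -> 0 < hprod_dot x x.
Proof. by move=> x0; rewrite hprod_dot_norm exprn_gt0// normr_gt0. Qed.

HB.instance Definition _ := isDotProduct.Build R[i] P hprod_dot hprod_dot_gt0.

HB.instance Definition _ := isHilbert.Build R P hprod_dot_norm.
End HProdNorm.

Section Operators.
Context (R : realType).

(* A linear operator defined on a subspace; its values outside [dom] are
   irrelevant. *)
Record operator (U V : normedModType R[i]) := Operator {
  dom : set U ;
  opfun :> U -> V ;
  dom0 : dom 0 ;
  domP : forall (a : R[i]) x y, dom x -> dom y -> dom (a *: x + y) ;
  opP : forall (a : R[i]) x y, dom x -> dom y ->
    opfun (a *: x + y) = a *: opfun x + opfun y
}.

Implicit Types U V H : normedModType R[i].

(* Cf. [linear_boundedP]: there is [C] with [`|f x| <= C * `|x|]. *)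
Definition bounded_op U V (f : {linear U -> V}) :=
  bounded_near f (nbhs (0 : U)).

(* Only meaningful for bounded [f]: [sup] is 0 on unbounded sets. *)
Definition opnorm U V (f : U -> V) : R :=
  sup [set complex.Re `|f x| | x in [set x | `|x| <= 1]].

Definition resolvent_set H (A : operator H H) : set R[i] :=
  [set l | exists B : {linear H -> H}, [/\ bounded_op B,
     forall y, dom A (B y) /\ l *: B y - A (B y) = y &
     forall x, dom A x -> B (l *: x - A x) = x]].

Definition spectrum H (A : operator H H) : set R[i] := ~` resolvent_set A.

Definition imaginary_axis : set R[i] := [set l | complex.Re l = 0].

(* Semigroups are indexed by [R]; only the operators [T t] with [0 <= t]
   matter, here and below. *)
Definition C0_semigroup H (T : R -> {linear H -> H}) :=
  [/\ forall t, 0 <= t -> bounded_op (T t),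
      T 0 =1 id,
      forall s t, 0 <= s -> 0 <= t -> T (s + t) =1 T s \o T t &
      forall x, T t x @[t --> 0^'+] --> x].

Definition diff_quotient H (T : R -> {linear H -> H}) (x : H) (t : R) : H :=
  (t^-1)%:C%C *: (T t x - x).

Definition generates H (A : operator H H) (T : R -> {linear H -> H}) :=
  [/\ C0_semigroup T,
      dom A = [set x | cvg (diff_quotient T x t @[t --> 0^'+])] &
      forall x, dom A x -> diff_quotient T x t @[t --> 0^'+] --> A x].

Definition contractive H (T : R -> {linear H -> H}) :=
  forall t x, 0 <= t -> `|T t x| <= `|x|.

Definition generates_contractive_C0_semigroup H (A : operator H H) :=
  exists2 T : R -> {linear H -> H}, generates A T & contractive T.

Definition exponentially_stable H (T : R -> {linear H -> H}) :=
  opnorm (T t) @[t --> +oo%R] --> (0 : R).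

Definition eventually_norm_continuous H (T : R -> {linear H -> H}) :=
  exists2 t0 : R, 0 <= t0 &
    forall t, t0 < t -> opnorm (fun x => T s x - T t x) @[s --> t] --> (0 : R).

Definition graph_norm U V (A : operator U V) (x : U) : R[i] :=
  sqrtC (`|A x| ^+ 2 + `|x| ^+ 2).

Definition compactly_embedded_dom U V (A : operator U V) :=
  precompact [set x | dom A x /\ graph_norm A x <= 1].

End Operators.

Arguments imaginary_axis {R}.

Section Hilbert.
Context (R : realType).
Implicit Types H : hilbertType R.

Definition coercive H (S : H -> H) :=
  exists2 nu : R, 0 < nu &
    forall h, nu * complex.Re (`|h| ^+ 2) <= complex.Re '[h, S h].

Definition numerical_range H (A : operator H H) : set R[i] :=
  [set '[v, A v] | v in [set v | dom A v /\ `|v| = 1]].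

Definition strip (eps : R) : set R[i] :=
  [set l | - eps <= complex.Re l <= 0].

Definition row_split (H1 H2 : hilbertType R) (A1 : operator (hprod H1 H2) H1)
    (A11 : operator H1 H1) (A12 : operator H2 H1) :=
  (forall h1 h2, dom A1 (h1, h2) <-> dom A11 h1 /\ dom A12 h2) /\
  (forall h1 h2, dom A11 h1 -> dom A12 h2 -> A1 (h1, h2) = A11 h1 + A12 h2).

Definition split_bounded_range (H1 H2 : hilbertType R)
    (A1 : operator (hprod H1 H2) H1) :=
  exists (A11 : operator H1 H1) (A12 : operator H2 H1), row_split A1 A11 A12 /\
    exists2 eps : R, 0 < eps &
      bounded_set (numerical_range A11 `&` strip eps : set R[i]^o).

End Hilbert.

Section ExtendedSystem.
Context (R : realType) (H1 H2 : hilbertType R).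
Variables (A1 : operator (hprod H1 H2) H1) (A21 : operator H1 H2).

Definition Aext_dom : set (hprod H1 H2) := [set h | dom A1 h /\ dom A21 h.1].
Definition Aext_fun (h : hprod H1 H2) : hprod H1 H2 := (A1 h, A21 h.1).

Lemma Aext_dom0 : Aext_dom 0.
Proof. by split; exact: dom0. Qed.

Lemma Aext_domP (a : R[i]) x y :
  Aext_dom x -> Aext_dom y -> Aext_dom (a *: x + y).
Proof. by move=> [x1 x2] [y1 y2]; split; exact: domP. Qed.

Lemma Aext_opP (a : R[i]) x y : Aext_dom x -> Aext_dom y ->
  Aext_fun (a *: x + y) = a *: Aext_fun x + Aext_fun y.
Proof.
by move=> [x1 x2] [y1 y2]; rewrite /Aext_fun (opP a x1 y1) (opP a x2 y2).
Qed.

Definition Aext : operator (hprod H1 H2) (hprod H1 H2) :=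
  Operator Aext_dom0 Aext_domP Aext_opP.

Variable S : {linear H2 -> H2}.

Definition AS_dom : set H1 :=
  [set h | dom A21 h /\ dom A1 (h, S (A21 h))].
Definition AS_fun (h : H1) : H1 := A1 (h, S (A21 h)).

Lemma AS_arg (a : R[i]) x y : dom A21 x -> dom A21 y ->
  ((a *: x + y, S (A21 (a *: x + y))) : hprod H1 H2) =
  a *: ((x, S (A21 x)) : hprod H1 H2) + (y, S (A21 y)).
Proof. by move=> Dx Dy; rewrite (opP a Dx Dy) linearP. Qed.

Lemma AS_dom0 : AS_dom 0.
Proof.
split; first exact: dom0.
have A210 : A21 0 = 0.
  by have := opP (-1) (dom0 A21) (dom0 A21); rewrite !scaleN1r !addNr.
by rewrite A210 linear0; exact: dom0.
Qed.

Lemma AS_domP (a : R[i]) x y : AS_dom x -> AS_dom y -> AS_dom (a *: x + y).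
Proof.
move=> [x1 x2] [y1 y2]; split; first exact: domP.
by rewrite AS_arg//; exact: domP.
Qed.

Lemma AS_opP (a : R[i]) x y : AS_dom x -> AS_dom y ->
  AS_fun (a *: x + y) = a *: AS_fun x + AS_fun y.
Proof. by move=> [x1 x2] [y1 y2]; rewrite /AS_fun AS_arg// (opP a x2 y2). Qed.

Definition AS : operator H1 H1 := Operator AS_dom0 AS_domP AS_opP.

End ExtendedSystem.

Section ComplexL2.
Context (R : realType) (d : measure_display) (Om : measurableType d).
Variable mu : {measure set Om -> \bar R}.

Definition cmeasurable (f : Om -> R[i]) :=
  measurable_fun setT (fun w => complex.Re (f w)) /\
  measurable_fun setT (fun w => complex.Im (f w)).

Definition L2fun (f : Om -> R[i]) :=
  cmeasurable f /\ (\int[mu]_w (complex.Re (`|f w| ^+ 2))%:E < +oo)%E.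

Definition cintegral (f : Om -> R[i]) : R[i] :=
  Complex (Rintegral mu setT (fun w => complex.Re (f w)))
          (Rintegral mu setT (fun w => complex.Im (f w))).

(* [cls] sends a square-integrable function to its class and identifies [H]
   with the space of these classes; two functions have the same class iff they
   are equal almost everywhere, by the second clause. The values of [cls] on
   other functions are irrelevant. *)
Definition is_L2 (H : hilbertType R) (cls : (Om -> R[i]) -> H) :=
  [/\ forall (a : R[i]) f g, L2fun f -> L2fun g ->
        cls (fun w => a * f w + g w) = a *: cls f + cls g,
      forall f g, L2fun f -> L2fun g ->
        '[cls f, cls g] = cintegral (fun w => f w * (g w)^*) &
      forall h, exists2 f, L2fun f & cls f = h].

(* In [R[i]], [0 <= z] means that [z] is real and nonnegative. *)
Definition nonneg_class (H : hilbertType R) (cls : (Om -> R[i]) -> H) (h : H) :=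
  exists f, [/\ L2fun f, cls f = h & {ae mu, forall w, 0 <= f w}].

End ComplexL2.

Definition positive_on_L2 (R : realType) (H : hilbertType R)
    (T : R -> {linear H -> H}) :=
  exists (d : measure_display) (Om : measurableType d)
    (mu : {measure set Om -> \bar R}) (cls : (Om -> R[i]) -> H),
  is_L2 mu cls /\
  forall t h, 0 <= t -> nonneg_class mu cls h -> nonneg_class mu cls (T t h).

(* Main.v *)
Require Import Defs.
From HB Require Import structures.
From mathcomp Require Import all_boot all_order all_algebra.
From mathcomp Require Import cyclic separable cyclotomic complex ring lra zify.
From mathcomp Require Import all_classical all_reals all_analysis.
From mathcomp Require Import measurable_realfun.
Import Order.TTheory GRing.Theory Num.Theory.
Import numFieldNormedType.Exports.
Local Open Scope classical_set_scope.
Local Open Scope ring_scope.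

(** Write [A_S] for the feedback operator and test the dissipativity of the
    extended operator on [(h, S A21 h)]: coercivity of [S] gives the energy
    inequality [Re (A_S h | h) <= - nu |A21 h|^2] ([AS_energy]).  So if
    [f = (i s - A_S) h] is small compared with [h], then [A21 h] is small as
    well, and [(h, S A21 h)] almost solves the homogeneous equation for the
    extended operator at the frequency [i s].  As [i s] is a resolvent point
    of that operator, [|(i s - A_S) h| >= c |h|] with [c > 0], locally
    uniformly in [s] ([AS_lower_bound], [AS_lower_bound_compact]).

    By the Gearhart-Pruess principle, exponential stability of a contraction
    semigroup on a Hilbert space follows once such a bound holds uniformly in
    all real [s] ([gearhart_exponentially_stable]), so that only high
    frequencies matter ([high_frequency_stable]).  There the question is
    whether unit vectors [h] can be approximate eigenvectors for arbitrarily
    large [s]: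
    - if the domain of [A21] embeds compactly, such [h], being bounded in the
      graph norm, stay in a compact set, so the norm of [A_S^-1 h] is bounded
      below because [A_S^-1] is injective; yet [A_S^-1 h] is of order [1 / s]
      ([compact_high_frequency]);
    - if the semigroup is norm continuous at [t], the resolvent
      [a (a - A_S)^-1] is almost the identity on [T t h] for large [a],
      uniformly in [h], but maps it to a vector of order [1 / s]
      ([norm_continuous_high_frequency]);
    - if the domain of [A1] splits, dissipativity makes the off-diagonal
      entries skew-adjoint to each other, so [(h | A11 h)] is [- i s] up to a
      small error, and such values would be unbounded in the strip
      ([AS_split_high_frequency]);
    - if the semigroup is positive, the resolvent at [a + i s] is dominated by
      the one at [a], which is bounded as [a] decreases to zero because zero is
      a resolvent point ([resolvent_domination], [cone_lower_bound]).

    Vector-valued integrals are avoided throughout: orbits are followed along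
    finite time grids whose step then tends to zero.  In particular the
    Gearhart-Pruess principle is obtained by cutting an orbit off with a tent
    function, which makes it a periodic solution of an implicit difference
    equation, and applying Parseval's identity on a finite cyclic group
    ([discrete_regularity], [sg_decay_dom]); and the resolvent is compared with
    the semigroup through a finite geometric sum, the discrete counterpart of
    the Laplace transform ([discrete_laplace]).  Surjectivity of [a - A_S] for
    [a >= 0] follows from the Lax-Milgram argument at [a = 0] ([AS_onto0]) and
    continuation along the real axis ([onto_pos]). *)

Set Implicit Arguments.
Unset Strict Implicit.

(** * Real-valued norms and inner products *)

Section RealNorm.
Context {R : realType}.
Implicit Types (V : normedModType R[i]) (H : hilbertType R).

Definition nrm V (x : V) : R := complex.Re `|x|.

Definition cmod (z : R[i]) : R := complex.Re `|z|.

Lemma normE V (x : V) : `|x| = (nrm x)%:C%C.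
Proof. by rewrite RRe_real// normr_real. Qed.

Lemma cnormE (z : R[i]) : `|z| = (cmod z)%:C%C.
Proof. by rewrite RRe_real// normr_real. Qed.

Lemma nrm_ge0 V (x : V) : 0 <= nrm x.
Proof. by rewrite -ler0c -normE. Qed.

Lemma nrm0 V : nrm (0 : V) = 0.
Proof. by rewrite /nrm normr0. Qed.

Lemma nrm_eq0 V (x : V) : nrm x = 0 -> x = 0.
Proof. by move=> x0; apply/normr0_eq0; rewrite normE x0. Qed.

Lemma nrmN V (x : V) : nrm (- x) = nrm x.
Proof. by rewrite /nrm normrN. Qed.

Lemma nrmD V (x y : V) : nrm (x + y) <= nrm x + nrm y.
Proof. by rewrite -lecR rmorphD /= -!normE ler_normD. Qed.

Lemma nrmB V (x y : V) : nrm (x - y) <= nrm x + nrm y.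
Proof. by rewrite -(nrmN y) nrmD. Qed.

Lemma nrm_distC V (x y : V) : nrm (x - y) = nrm (y - x).
Proof. by rewrite /nrm distrC. Qed.

Lemma nrm_le_sub V (x y : V) : nrm x <= nrm y + nrm (x - y).
Proof. by rewrite -{1}(subrKC y x) nrmD. Qed.

Lemma cmod_ge0 (z : R[i]) : 0 <= cmod z.
Proof. by rewrite -ler0c -cnormE. Qed.

Lemma nrmZ V (a : R[i]) (x : V) : nrm (a *: x) = cmod a * nrm x.
Proof. by apply: complexI; rewrite -normE normrZ normE cnormE rmorphM. Qed.

Lemma cmodR (r : R) : cmod r%:C%C = `|r|.
Proof. by rewrite /cmod normc_def /= expr0n addr0 sqrtr_sqr. Qed.

Lemma cmodM (a b : R[i]) : cmod (a * b) = cmod a * cmod b.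
Proof. by apply: complexI; rewrite -cnormE normrM !cnormE rmorphM. Qed.

Lemma cmodD (a b : R[i]) : cmod (a + b) <= cmod a + cmod b.
Proof. by rewrite -lecR rmorphD /= -!cnormE ler_normD. Qed.

Lemma cmodN (a : R[i]) : cmod (- a) = cmod a.
Proof. by rewrite /cmod normrN. Qed.

Lemma cmodX (a : R[i]) n : cmod (a ^+ n) = cmod a ^+ n.
Proof. by apply: complexI; rewrite -cnormE normrX cnormE rmorphXn. Qed.

Lemma cmodV (a : R[i]) : cmod a^-1 = (cmod a)^-1.
Proof. by apply: complexI; rewrite -cnormE normfV cnormE fmorphV. Qed.

Lemma cmod_sqr (a : R[i]) : cmod a ^+ 2 = complex.Re a ^+ 2 + complex.Im a ^+ 2.
Proof. by apply: complexI; rewrite rmorphXn /= -cnormE -add_Re2_Im2. Qed.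

Lemma Re_le_cmod (a : R[i]) : `|complex.Re a| <= cmod a.
Proof. by rewrite -lecR -cnormE normc_ge_Re. Qed.

Lemma Im_le_cmod (a : R[i]) : `|complex.Im a| <= cmod a.
Proof.
rewrite -ler_sqr ?nnegrE ?normr_ge0 ?cmod_ge0// cmod_sqr real_normK ?num_real//.
by rewrite lerDr sqr_ge0.
Qed.

Lemma cmod_le_ReIm (a : R[i]) : cmod a <= `|complex.Re a| + `|complex.Im a|.
Proof.
rewrite -ler_sqr ?nnegrE ?addr_ge0 ?normr_ge0 ?cmod_ge0// cmod_sqr sqrrD.
by rewrite !real_normK ?num_real// addrAC lerDl mulrn_wge0// mulr_ge0.
Qed.

Lemma nrmZR V (r : R) (x : V) : nrm (r%:C%C *: x) = `|r| * nrm x.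
Proof. by rewrite nrmZ cmodR. Qed.

Lemma nrm_sum V (I : Type) (s : seq I) (P : pred I) (F : I -> V) :
  nrm (\sum_(i <- s | P i) F i) <= \sum_(i <- s | P i) nrm (F i).
Proof.
elim/big_ind2 : _ => //; first by rewrite nrm0.
by move=> x a y b xa yb; rewrite (le_trans (nrmD _ _))// lerD.
Qed.

Lemma cmod_sum (I : Type) (s : seq I) (P : pred I) (F : I -> R[i]) :
  cmod (\sum_(i <- s | P i) F i) <= \sum_(i <- s | P i) cmod (F i).
Proof.
elim/big_ind2 : _ => //; first by rewrite /cmod normr0.
by move=> x a y b xa yb; rewrite (le_trans (cmodD _ _))// lerD.
Qed.

Lemma cvg_nrmP V (T : Type) (F : set_system T) {FF : Filter F} (f : T -> V) l :
  f @ F --> l <-> forall e : R, 0 < e -> \forall t \near F, nrm (f t - l) < e.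
Proof.
split=> [/cvgrPdist_lt fl e e0|fl].
  have /fl : 0 < (e%:C)%C by rewrite ltcR.
  by apply: filterS => t; rewrite distrC normE ltcR.
apply/cvgrPdist_lt => e e0; have eE : e = (complex.Re e)%:C%C.
  by rewrite RRe_real// gtr0_real.
have : 0 < complex.Re e by rewrite -ltcR -eE.
by move=> /fl; apply: filterS => t; rewrite distrC normE eE ltcR.
Qed.

Definition rdot H (x y : H) : R := complex.Re '[x, y].

Lemma rdotxx H (x : H) : rdot x x = nrm x ^+ 2.
Proof.
by rewrite /rdot hdot_norm normE -rmorphXn.
Qed.

Lemma hdotC H (x y : H) : '[x, y] = ('[y, x]^*)%C.
Proof. by rewrite hermC expr0 mul1r. Qed.

Lemma rdotC H (x y : H) : rdot x y = rdot y x.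
Proof. by rewrite /rdot hdotC; case: '[y, x]. Qed.

Lemma rdotDl H (x y z : H) : rdot (x + y) z = rdot x z + rdot y z.
Proof. by rewrite /rdot linearDl /= raddfD. Qed.

Lemma rdotDr H (x y z : H) : rdot z (x + y) = rdot z x + rdot z y.
Proof. by rewrite !(rdotC z) rdotDl. Qed.

Lemma rdotNl H (x z : H) : rdot (- x) z = - rdot x z.
Proof. by rewrite /rdot linearNl /= raddfN. Qed.

Lemma rdotNr H (x z : H) : rdot z (- x) = - rdot z x.
Proof. by rewrite !(rdotC z) rdotNl. Qed.

Lemma hdotZl H a (x z : H) : '[a *: x, z] = a * '[x, z].
Proof. by rewrite linearZl_LR. Qed.

Lemma hdotZr H a (x z : H) : '[z, a *: x] = (a^*)%C * '[z, x].
Proof. by rewrite linearZr_LR. Qed.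

Lemma rdotZl H (r : R) (x z : H) : rdot (r%:C%C *: x) z = r * rdot x z.
Proof. by rewrite /rdot hdotZl; case: '[x, z] => a b /=; rewrite mul0r subr0. Qed.

Lemma rdotZr H (r : R) (x z : H) : rdot z (r%:C%C *: x) = r * rdot z x.
Proof. by rewrite !(rdotC z) rdotZl. Qed.

Lemma nrmD_sqr H (x y : H) :
  nrm (x + y) ^+ 2 = nrm x ^+ 2 + nrm y ^+ 2 + 2 * rdot x y.
Proof. by rewrite -!rdotxx rdotDl !rdotDr (rdotC y x); ring. Qed.

Lemma hdot_le H (x y : H) : cmod '[x, y] <= nrm x * nrm y.
Proof.
have [->|x0] := eqVneq x 0; first by rewrite linear0l /cmod normr0 nrm0 mul0r.
have xn : 0 < nrm x.
  by rewrite lt_neqAle nrm_ge0 andbT; apply: contra_neq x0 => /esym/nrm_eq0.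
pose a := '[y, x] / ((nrm x) ^+ 2)%:C%C.
have : 0 <= nrm (y - a *: x) ^+ 2 by rewrite sqr_ge0.
have -> : nrm (y - a *: x) ^+ 2 = nrm y ^+ 2 - cmod '[x, y] ^+ 2 / nrm x ^+ 2.
  rewrite nrmD_sqr nrmN nrmZ cmodM cmodV cmodR ger0_norm ?sqr_ge0//.
  have -> : rdot y (- (a *: x)) = - (cmod '[y, x] ^+ 2 / nrm x ^+ 2).
    rewrite rdotNr /rdot hdotZr /a -fmorphV cmod_sqr; case: '[y, x] => p q /=.
    by ring.
  have -> : cmod '[x, y] = cmod '[y, x].
    by rewrite hdotC /cmod normcJ.
  by field; rewrite gt_eqF.
rewrite subr_ge0 ler_pdivrMr ?exprn_gt0// -exprMn ler_sqr ?nnegrE ?cmod_ge0//.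
  by rewrite mulrC.
by rewrite mulr_ge0 ?nrm_ge0.
Qed.

Lemma rdot_le H (x y : H) : rdot x y <= nrm x * nrm y.
Proof.
apply: le_trans (hdot_le x y); apply: le_trans (Re_le_cmod _).
by rewrite /rdot ler_norm.
Qed.

Lemma rdot_ge H (x y : H) : - (nrm x * nrm y) <= rdot x y.
Proof. by rewrite lerNl -rdotNl (le_trans (rdot_le _ _))// nrmN. Qed.

Lemma bounded_opP (U V : normedModType R[i]) (f : {linear U -> V}) :
  bounded_op f -> exists2 C, 0 <= C & forall x, nrm (f x) <= C * nrm x.
Proof.
move=> /linear_boundedP/pinfty_ex_gt0[C C0 fC].
have CE : C = (complex.Re C)%:C%C by rewrite RRe_real// gtr0_real.
exists (complex.Re C); first by rewrite -ler0c -CE ltW.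
by move=> x; have := fC x; rewrite !normE CE -rmorphM lecR.
Qed.

Lemma prod_fst_le (U V : hilbertType R) (x : hprod U V) : nrm x.1 <= nrm x.
Proof. by rewrite -lecR -!normE hprod_fst_le. Qed.

Lemma prod_snd_le (U V : hilbertType R) (x : hprod U V) : nrm x.2 <= nrm x.
Proof. by rewrite -lecR -!normE hprod_snd_le. Qed.

Lemma prod_nrm_le (U V : hilbertType R) (x : hprod U V) :
  nrm x <= nrm x.1 + nrm x.2.
Proof. by rewrite -lecR rmorphD /= -!normE hprod_norm_le. Qed.

Lemma prod_rdot (U V : hilbertType R) (x y : hprod U V) :
  rdot x y = rdot x.1 y.1 + rdot x.2 y.2.
Proof. by rewrite /rdot -raddfD. Qed.

End RealNorm.

(** * Completeness: fixed points and uniform boundedness *)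

(** A complex space with its scalars restricted to the reals.  Norm and
    completeness are unchanged, so that the contraction principle and the
    uniform boundedness principle for real spaces apply to complex ones. *)
Definition realified (R : realType) (V : normedModType R[i]) : Type := V.

Section Realified.
Context {R : realType} (V : normedModType R[i]).
Notation rV := (@realified R V).

HB.instance Definition _ := GRing.Zmodule.copy rV V.

Definition realified_scale (r : R) (x : rV) : rV := (r%:C%C *: (x : V)).

Lemma realified_scaleA (a b : R) (v : rV) :
  realified_scale a (realified_scale b v) = realified_scale (a * b) v.
Proof. by rewrite /realified_scale scalerA -rmorphM. Qed.

Lemma realified_scale1 : left_id 1 realified_scale.
Proof. by move=> x; exact: (@scale1r _ V). Qed.

Lemma realified_scaleDr : right_distributive realified_scale +%R.
Proof. by move=> a x y; exact: (@scalerDr _ V). Qed.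

Lemma realified_scaleDl (v : rV) :
  {morph realified_scale^~ v : a b / a + b}.
Proof. by move=> a b; rewrite /realified_scale rmorphD (@scalerDl _ V). Qed.

HB.instance Definition _ := GRing.Zmodule_isLmodule.Build R rV
  realified_scaleA realified_scale1 realified_scaleDr realified_scaleDl.

Lemma realified_normZ (l : R) (x : rV) :
  nrm ((l *: x : rV) : V) = `|l| * nrm (x : V).
Proof. exact: nrmZR. Qed.

HB.instance Definition _ := Lmodule_isNormed.Build R rV
  (@nrmD R V) realified_normZ (@nrm_eq0 R V).

End Realified.

Section RealifiedComplete.
Context {R : realType} (V : completeNormedModType R[i]).
Notation rV := (@realified R V).

Lemma realified_complete (F : set_system rV) :
  ProperFilter F -> cauchy F -> cvg F.
Proof.
move=> FF /cauchy_ballP Fc.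
have Fc' : cauchy (F : set_system V).
  apply/cauchy_ballP => e e0; have eE : e = (complex.Re e)%:C%C.
    by rewrite RRe_real// gtr0_real.
  have e0' : 0 < complex.Re e by rewrite -ltcR -eE.
  have := Fc _ e0'; apply: filterS => -[x y].
  rewrite /= -!ball_normE /= => xy.
  by rewrite normE eE ltcR.
have [l Fl] : exists l : V, (F : set_system V) --> l.
  by apply/cvg_ex; exact: (@cauchy_cvg V F FF Fc').
apply/cvg_ex; exists (l : rV); apply/cvgrPdist_lt => e e0.
have /cvg_nrmP/(_ e e0) := Fl; apply: filterS => t.
by rewrite nrm_distC.
Qed.

HB.instance Definition _ := Uniform_isComplete.Build rV realified_complete.

End RealifiedComplete.

Lemma contraction_fixpoint (R : realType) (V : completeNormedModType R[i])
    (G : V -> V) (q : R) : 0 <= q -> q < 1 ->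
  (forall x y, nrm (G x - G y) <= q * nrm (x - y)) -> exists x, x = G x.
Proof.
move=> q0 q1 Gq.
have Gf : set_fun (@setT (realified V)) setT (G : realified V -> realified V).
  by [].
pose Gp : {fun (@setT (realified V)) >-> (@setT (realified V))} :=
  HB.pack (G : realified V -> realified V) (isFun.Build _ _ _ _ _ Gf).
have ctr : is_contraction Gp.
  exists (NngNum q0); split => //= -[x y] _ /=.
  exact: Gq.
have [||p _ pG] := banach_fixed_point ctr.
- exact: closedT.
- by exists (0 : realified V).
- by exists p.
Qed.

Lemma uniform_boundedness (R : realType) (V : completeNormedModType R[i])
    (W : normedModType R[i]) (F : set (V -> W)) :
  (forall f, F f -> linear f /\ exists C, forall x, nrm (f x) <= C * nrm x) ->
  (forall x, exists M, forall f, F f -> nrm (f x) <= M) ->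
  exists M, forall f, F f -> forall x, nrm (f x) <= M * nrm x.
Proof.
move=> Flin Fpt.
have UB : @uniform_bounded R (realified V) (realified W) F.
  apply: (@Banach_Steinhauss R (realified V) (realified W) F _ Fpt) => f /Flin[lf [C fC]]; split.
    move=> r; exists (`|C| * `|r|) => x xr.
    apply: (le_trans (fC x)); apply: (le_trans (ler_norm _)).
    rewrite normrM ler_wpM2l//.
    rewrite ger0_norm ?nrm_ge0//.
    exact: le_trans xr (ler_norm _).
  by move=> a x y; exact: lf.
have [M FM'] := UB 1.
have FM f : F f -> forall x : V, nrm x <= 1 -> nrm (f x) <= M := FM' f.
exists M => f Ff x.
have [->|x0] := eqVneq x 0.
  have [lf _] := Flin _ Ff.
  have -> : f 0 = 0.
    by have := lf (-1) 0 0; rewrite !scaleN1r !addNr.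
  by rewrite !nrm0 mulr0.
have xn : 0 < nrm x.
  by rewrite lt_neqAle nrm_ge0 andbT; apply: contra_neq x0 => /esym/nrm_eq0.
have [lf _] := Flin _ Ff.
have := FM f Ff ((nrm x)^-1%:C%C *: x).
have -> : f ((nrm x)^-1%:C%C *: x) = (nrm x)^-1%:C%C *: f x.
  have f0 : f 0 = 0 by have := lf (-1) 0 0; rewrite !scaleN1r !addNr.
  by have := lf ((nrm x)^-1%:C%C) x 0; rewrite !addr0 f0 addr0.
rewrite !nrmZR ger0_norm ?invr_ge0 ?nrm_ge0//.
by rewrite mulVf ?gt_eqF// mulrC ler_pdivrMr//; apply.
Qed.

(** * Elementary semigroup theory *)

Lemma near_at_right0 (R : realType) (P : R -> Prop) :
  (\forall t \near 0^'+, P t) <->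
  exists2 d : R, 0 < d & forall t, 0 < t -> t < d -> P t.
Proof.
split.
  rewrite near_withinE near_simpl => /nbhs_ballP[d /= d0 dP].
  exists d => // t t0 td; apply: dP => //.
  by rewrite -ball_normE /= sub0r normrN gtr0_norm.
move=> [d d0 dP]; rewrite near_withinE near_simpl; apply/nbhs_ballP.
exists d => //= t; rewrite -ball_normE /= sub0r normrN => td t0.
by apply: dP => //; rewrite -(gtr0_norm t0).
Qed.

(** Proves identities between signed sums in an abelian group by cancelling
    the leading term against its opposite, wherever the latter stands. *)
Ltac zmod_cancel x :=
  first [ rewrite (addKr x) | rewrite (addNKr x) | rewrite (subrr x)
        | rewrite (addNr x)
        | rewrite (addrCA x); zmod_cancel x
        | rewrite (addrCA (- x)); zmod_cancel x ].

Ltac zmod := apply: subr0_eq; rewrite ?(opprD, opprK, addr0, add0r, oppr0) -?addrA;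
  repeat (rewrite ?addr0 ?add0r; lazymatch goal with
  | |- - ?x + _ = 0 => zmod_cancel x
  | |- ?x + _ = 0 => zmod_cancel x
  end); try by [].

Lemma le_of_error (R : realType) (a b K : R) :
  (forall eta, 0 < eta -> eta <= 1 -> a <= b + K * eta) -> a <= b.
Proof.
move=> abK; apply/ler_addgt0Pr => e e0.
have K0 : 0 < `|K| + 1 by rewrite ltr_wpDl.
pose eta := Num.min 1 (e / (`|K| + 1)).
have eta0 : 0 < eta by rewrite lt_min ltr01 divr_gt0.
have /(_ eta0) := abK eta; rewrite ge_min lexx => /(_ isT) /le_trans; apply.
rewrite lerD2l (@le_trans _ _ (`|K| * eta))//.
  by apply: ler_wpM2r; [exact: ltW|exact: ler_norm].
rewrite (@le_trans _ _ ((`|K| + 1) * (e / (`|K| + 1))))//.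
  apply: ler_pM; [exact: normr_ge0|exact: ltW|by rewrite lerDl|].
  by rewrite ge_min lexx orbT.
by rewrite mulrC divfK// gt_eqF.
Qed.

Lemma small_step (R : realType) (t d : R) : 0 < d -> exists n, t / n.+1%:R < d.
Proof.
move=> d0; exists (Num.truncn (`|t| / d)).
rewrite ltr_pdivrMr// -ltr_pdivrMl// mulrC.
apply: le_lt_trans (truncnS_gt _).
by apply: ler_wpM2r; [rewrite invr_ge0 ltW|exact: ler_norm].
Qed.

Section OperatorBasics.
Context {R : realType} {U V : normedModType R[i]} (A : operator U V).

Lemma domZ a x : dom A x -> dom A (a *: x).
Proof. by move=> Dx; rewrite -[_ *: _]addr0; apply: domP => //; exact: dom0. Qed.

Lemma domD x y : dom A x -> dom A y -> dom A (x + y).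
Proof. by move=> Dx Dy; rewrite -[x]scale1r; exact: domP. Qed.

Lemma opD x y : dom A x -> dom A y -> A (x + y) = A x + A y.
Proof.
by move=> Dx Dy; have := opP 1 Dx Dy; rewrite !scale1r.
Qed.

Lemma op0 : A 0 = 0.
Proof. by have := opP (-1) (dom0 A) (dom0 A); rewrite !scaleN1r !addNr. Qed.

Lemma opZ a x : dom A x -> A (a *: x) = a *: A x.
Proof.
by move=> Dx; have := opP a Dx (dom0 A); rewrite !addr0 op0 addr0.
Qed.

Lemma opB x y : dom A x -> dom A y -> A (x - y) = A x - A y.
Proof.
move=> Dx Dy; rewrite -scaleN1r opD//; last exact: domZ.
by rewrite opZ// scaleN1r.
Qed.

Lemma domB x y : dom A x -> dom A y -> dom A (x - y).
Proof. by move=> Dx Dy; rewrite -scaleN1r; apply: domD => //; exact: domZ. Qed.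

Lemma dom_sum (I : Type) (s : seq I) (F : I -> U) :
  (forall i, dom A (F i)) -> dom A (\sum_(i <- s) F i).
Proof. by move=> DF; elim/big_rec : _ => [|i x _ Dx]; [exact: dom0|exact: domD]. Qed.

Lemma op_sum (I : Type) (s : seq I) (F : I -> U) :
  (forall i, dom A (F i)) -> A (\sum_(i <- s) F i) = \sum_(i <- s) A (F i).
Proof.
move=> DF; elim: s => [|i s ih]; first by rewrite !big_nil op0.
by rewrite !big_cons opD ?ih//; exact: dom_sum.
Qed.

End OperatorBasics.

Section Semigroup.
Context {R : realType} {H : hilbertType R} {A : operator H H}.
Context {T : R -> {linear H -> H}} (genT : generates A T).
Implicit Types (x y z : H) (t h e : R).

Let C0T : C0_semigroup T. Proof. by case: genT. Qed.

Lemma sgD s t x : 0 <= s -> 0 <= t -> T (s + t) x = T s (T t x).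
Proof. by move=> s0 t0; have [_ _ ->] := C0T. Qed.

Lemma sg0 x : T 0 x = x.
Proof. by have [_ -> _ _] := C0T. Qed.

Lemma sgC s t x : 0 <= s -> 0 <= t -> T s (T t x) = T t (T s x).
Proof. by move=> s0 t0; rewrite -!sgD// addrC. Qed.

Lemma sg_bound t : 0 <= t -> exists2 C, 0 <= C & forall x, nrm (T t x) <= C * nrm x.
Proof. by move=> t0; apply: bounded_opP; have [/(_ t t0)] := C0T. Qed.

Lemma sg_right_continuous x e : 0 < e ->
  exists2 d, 0 < d & forall t, 0 <= t -> t < d -> nrm (T t x - x) < e.
Proof.
move=> e0; have [_ _ _ /(_ x)] := C0T.
move=> /cvg_nrmP/(_ e e0)/near_at_right0[d d0 dP]; exists d => // t t0 td.
have [t1|] := ltP 0 t; first exact: dP.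
by move=> t1; rewrite (@le_anti _ _ t 0) ?t0 ?t1// sg0 subrr nrm0.
Qed.

Lemma diff_quotientE x y h : 0 < h ->
  nrm (diff_quotient T x h - y) * h = nrm (T h x - x - h%:C%C *: y).
Proof.
move=> h0; rewrite mulrC -{1}(gtr0_norm h0) -nrmZR scalerBr /diff_quotient.
by rewrite scalerA -rmorphM divff ?gt_eqF// scale1r.
Qed.

Lemma sg_expand x e : dom A x -> 0 < e ->
  exists2 d, 0 < d & forall h, 0 < h -> h < d ->
    nrm (T h x - x - h%:C%C *: A x) <= h * e.
Proof.
move=> Dx e0; have [_ _ /(_ x Dx)] := genT.
move=> /cvg_nrmP/(_ e e0)/near_at_right0[d d0 dP]; exists d => // h h0 hd.
by rewrite -diff_quotientE// mulrC ler_pM2l// ltW// dP.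
Qed.

Lemma sg_generatorP x y :
  (forall e, 0 < e -> exists2 d, 0 < d & forall h, 0 < h -> h < d ->
    nrm (T h x - x - h%:C%C *: y) <= h * e) ->
  dom A x /\ A x = y.
Proof.
move=> xy.
have cxy : diff_quotient T x t @[t --> 0^'+] --> y.
  apply/cvg_nrmP => e e0; apply/near_at_right0.
  have [|d d0 dP] := xy (e / 2); first by rewrite divr_gt0.
  exists d => // h h0 hd; rewrite -(ltr_pM2r h0) diff_quotientE//.
  by rewrite (le_lt_trans (dP _ h0 hd))// mulrC ltr_pM2r// ltr_pdivrMr// ltr_pMr// ltr1n.
have [_ DA AT] := genT.
have Dx : dom A x by rewrite DA /=; apply/cvg_ex; exists y.
by split => //; apply: (cvg_unique _ (AT _ Dx) cxy); exact: norm_hausdorff.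
Qed.

Lemma sg_dom x t : 0 <= t -> dom A x -> dom A (T t x) /\ A (T t x) = T t (A x).
Proof.
move=> t0 Dx; apply: sg_generatorP => e e0.
have [C C0 TC] := sg_bound t0.
have [|d d0 dP] := sg_expand (e := e / (C + 1)) Dx.
  by rewrite divr_gt0// ltr_wpDl.
exists d => // h h0 hd.
have -> : T h (T t x) - T t x - h%:C%C *: T t (A x) =
    T t (T h x - x - h%:C%C *: A x).
  by rewrite (sgC _ (ltW h0) t0) !(linearB (T t)) (linearZ_LR (T t)).
rewrite (le_trans (TC _))//.
rewrite (@le_trans _ _ (C * (h * (e / (C + 1)))))//.
  by rewrite ler_wpM2l// dP.
have C1 : 0 < C + 1 by rewrite ltr_wpDl.
rewrite mulrCA ler_pM2l// mulrA ler_pdivrMr// mulrC ler_pM2l//.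
by rewrite lerDl.
Qed.

(** Strong continuity only says that each orbit is bounded near time zero; the
    uniform boundedness principle makes the bound uniform over the orbits. *)
Lemma sg_bound_near0 : exists2 d, 0 < d & exists M, forall t x,
  0 <= t -> t <= d -> nrm (T t x) <= M * nrm x.
Proof.
apply: contrapT => unb.
have bad n : exists t, [/\ 0 <= t, t <= n.+1%:R^-1 &
    exists x, n%:R * nrm x < nrm (T t x)].
  apply: contrapT => nbad; apply: unb; exists n.+1%:R^-1; first by rewrite invr_gt0.
  exists n%:R => t x t0 tn; rewrite leNgt; apply/negP => xt.
  by apply: nbad; exists t; split => //; exists x.
have [t_ tP] := choice bad.
have t0 n : 0 <= t_ n by case: (tP n).
have [|x|M FM] := @uniform_boundedness R H H [set (T (t_ n) : H -> H) | n in setT].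
- move=> _ [n _ <-]; split; first by move=> a x y; rewrite linearP.
  by have [C _ TC] := sg_bound (t0 n); exists C.
- have [d d0 dP] := sg_right_continuous x ltr01.
  have [n nd] := small_step 1 d0.
  exists (nrm x + 1 + \sum_(k < n.+1) nrm (T (t_ k) x)); move=> _ [k _ <-].
  have [kn|nk] := ltnP k n.+1.
    rewrite (bigD1 (Ordinal kn))//= addrCA lerDl !addr_ge0 ?nrm_ge0//.
    by rewrite sumr_ge0// => i _; exact: nrm_ge0.
  rewrite (@le_trans _ _ (nrm x + 1))//.
    rewrite (le_trans (nrm_le_sub _ x))// lerD2l ltW// dP//.
    have [_ tk _] := tP k; apply: le_lt_trans nd; rewrite mul1r (le_trans tk)//.
    by rewrite lef_pV2 ?posrE// ler_nat ltnW.
  by rewrite lerDl sumr_ge0// => i _; exact: nrm_ge0.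
have Mn := truncnS_gt M; set n := (Num.truncn M).+1 in Mn.
have [_ _ [x]] := tP n; rewrite ltNge => /negP; apply.
have := FM (T (t_ n)) (ex_intro2 _ _ n I erefl) x => /le_trans; apply.
by rewrite ler_wpM2r ?nrm_ge0// ltW.
Qed.

Lemma sg_bound_on b : exists2 M, 1 <= M & forall t x,
  0 <= t -> t <= b -> nrm (T t x) <= M * nrm x.
Proof.
have [d d0 [M0 MP]] := sg_bound_near0.
pose M := Num.max 1 M0.
have M1 : 1 <= M by rewrite le_max lexx.
have M_ge0 : 0 <= M by exact: le_trans M1.
have TM t x : 0 <= t -> t <= d -> nrm (T t x) <= M * nrm x.
  move=> t0 td; rewrite (le_trans (MP _ _ t0 td))// ler_wpM2r ?nrm_ge0//.
  by rewrite le_max lexx orbT.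
have step n t x : 0 <= t -> t <= n%:R * d -> nrm (T t x) <= M ^+ n * nrm x.
  elim: n t => [|n ih] t t0 tn.
    rewrite mul0r in tn.
    by rewrite (@le_anti _ _ t 0) ?t0 ?tn// sg0 expr0 mul1r.
  have [td|td] := leP t d.
    rewrite (le_trans (TM _ _ t0 td))// ler_wpM2r ?nrm_ge0//.
    by rewrite exprS ler_peMr// exprn_ege1.
  have td0 : 0 <= t - d by rewrite subr_ge0 ltW.
  rewrite -(subrKC d t) (sgD _ (ltW d0) td0).
  apply: le_trans (TM _ _ (ltW d0) (lexx d)) _.
  rewrite exprS -mulrA ler_wpM2l// ih//.
  by rewrite -natr1 mulrDl mul1r in tn; rewrite lerBlDr.
have [n nb] := small_step b d0.
exists (M ^+ n.+1); first by rewrite exprn_ege1.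
move=> t x t0 tb; apply: step => //; apply: le_trans tb _.
by rewrite mulrC -ler_pdivrMr// ltW.
Qed.

End Semigroup.

(** * Dissipative operators *)

Section Dissipative.
Context {R : realType} {H : hilbertType R}.
Implicit Types (A : operator H H) (l : R[i]) (c : R).

Definition dissipative A := forall x, dom A x -> rdot (A x) x <= 0.

Definition lower_bound A l c :=
  forall y, dom A y -> c * nrm y <= nrm (l *: y - A y).

Definition onto A l := forall f, exists y, dom A y /\ l *: y - A y = f.

Lemma rdot_selfZ l (y : H) : rdot (l *: y) y = complex.Re l * nrm y ^+ 2.
Proof.
rewrite /rdot hdotZl hdot_norm normE -rmorphXn /=.
by case: l => a b /=; rewrite mulr0 subr0.
Qed.

Lemma dissipative_lower_bound A l : dissipative A ->
  lower_bound A l (complex.Re l).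
Proof.
move=> dA y Dy.
have [->|y0] := eqVneq (nrm y) 0; first by rewrite mulr0 nrm_ge0.
have yn : 0 < nrm y by rewrite lt_neqAle eq_sym y0 nrm_ge0.
rewrite -(ler_pM2r yn) -mulrA -expr2 -rdot_selfZ.
apply: le_trans (rdot_le _ _); rewrite rdotDl rdotNl lerDl.
by rewrite oppr_ge0 dA.
Qed.

Lemma lower_bound_shift A l l' c :
  lower_bound A l c -> lower_bound A l' (c - cmod (l' - l)).
Proof.
move=> lb y Dy; rewrite mulrBl lerBlDr -nrmZ.
apply: le_trans (lb y Dy) _.
apply: le_trans (nrm_le_sub _ (l' *: y - A y)) _.
by rewrite lerD2l opprB subrKA nrm_distC -scalerBl.
Qed.

Lemma lower_bound_weaken A l c c' :
  c' <= c -> lower_bound A l c -> lower_bound A l c'.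
Proof.
by move=> cc' lb y Dy; apply: le_trans (lb y Dy); rewrite ler_wpM2r ?nrm_ge0.
Qed.

(** Close to the imaginary axis the bound is inherited from the axis, and away
    from it dissipativity provides one. *)
Lemma dissipative_half_plane A c : dissipative A ->
  (forall s : R, lower_bound A (Complex 0 s) c) ->
  forall l, 0 <= complex.Re l -> lower_bound A l (c / 2).
Proof.
move=> dA lb [a s] /= a0.
have [ca|ac] := leP (c / 2) a.
  exact: lower_bound_weaken ca (dissipative_lower_bound (Complex a s) dA).
apply: lower_bound_weaken (lower_bound_shift (Complex a s) (lb s)).
have -> : Complex a s - Complex 0 s = a%:C%C :> R[i].
  by apply/eqP; rewrite eq_complex /= subr0 subrr !eqxx.
by rewrite cmodR ger0_norm//; lra.
Qed.

(** The equation at [l'] is a fixed point equation for the inverse at [l],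
    contracting because that inverse is [c^-1]-Lipschitz. *)
Lemma onto_shift A l l' c : 0 < c -> lower_bound A l c -> onto A l ->
  cmod (l' - l) < c -> onto A l'.
Proof.
move=> c0 lb surj ll' f.
have [B BP] := choice surj.
have DB g : dom A (B g) by case: (BP g).
have BE g : l *: B g - A (B g) = g by case: (BP g).
have Blip g g' : nrm (B g - B g') <= c^-1 * nrm (g - g').
  rewrite -ler_pdivrMl ?invr_gt0// invrK.
  apply: le_trans (lb _ (domB (DB g) (DB g'))) _.
  have -> : l *: (B g - B g') - A (B g - B g') = g - g'.
    rewrite opB// -[in RHS](BE g) -[in RHS](BE g') scalerBr.
    by rewrite !opprD !opprK addrACA.
  exact: lexx.
have [||x y|x xE] := @contraction_fixpoint R H
  (fun x => B (f - (l' - l) *: x)) (cmod (l' - l) / c).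
- by rewrite divr_ge0 ?cmod_ge0// ltW.
- by rewrite ltr_pdivrMr// mul1r.
- apply: le_trans (Blip _ _) _.
  rewrite opprB addrC subrKA -scalerBr nrmZ.
  by rewrite (nrm_distC y) mulrCA mulrA.
exists x; split; first by rewrite xE.
have := BE (f - (l' - l) *: x); rewrite -xE => xf.
rewrite -(subrK ((l' - l) *: x) f) -xf scalerBl.
by rewrite addrAC subrKC.
Qed.

(** The lower bound [c / 2] holds on the whole half-line, so that steps of
    length [c / 3] can be iterated indefinitely. *)
Lemma onto_pos A c : 0 < c -> dissipative A -> lower_bound A 0 c ->
  onto A 0 -> forall a : R, 0 <= a -> onto A a%:C%C.
Proof.
move=> c0 dA lb surj.
have lbp (a : R) : 0 <= a -> lower_bound A a%:C%C (c / 2).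
  move=> a0; have [ca|ac] := leP (c / 2) a.
    exact: lower_bound_weaken ca (dissipative_lower_bound a%:C%C dA).
  apply: lower_bound_weaken (lower_bound_shift a%:C%C lb).
  by rewrite subr0 cmodR ger0_norm//; lra.
have step n : forall a : R, 0 <= a -> a <= n%:R * (c / 3) -> onto A a%:C%C.
  elim: n => [|n ih] a a0 an.
    by rewrite mul0r in an; rewrite (@le_anti _ _ a 0) ?a0 ?an.
  have [ac|ca] := leP a (c / 3).
    apply: (onto_shift c0 lb surj).
    by rewrite subr0 cmodR ger0_norm//; lra.
  have a'0 : 0 <= a - c / 3 by rewrite subr_ge0 ltW.
  have c20 : 0 < c / 2 by lra.
  apply: (onto_shift c20 (lbp _ a'0) (ih _ a'0 _)).
    by move: an; rewrite -natr1 mulrDl mul1r; lra.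
  by rewrite -rmorphB cmodR opprB subrKC ger0_norm; lra.
move=> a a0; have c30 : 0 < c / 3 by lra.
have [n nb] := small_step a c30.
by apply: (step n.+1) => //; rewrite mulrC -ler_pdivrMr// ltW.
Qed.

End Dissipative.

(** * Contractivity and density of the domain *)

Section DissipativeSemigroup.
Context {R : realType} {H : hilbertType R} {A : operator H H}.
Context {T : R -> {linear H -> H}} (genT : generates A T) (dA : dissipative A).
Implicit Types (x y : H) (t h : R).

(** For [m = 1 + l h] and [v] close to [h (l y - A y)], this is a Riemann sum
    for the Laplace transform that expresses the resolvent at [l] through the
    semigroup. *)
Lemma discrete_laplace (m : R[i]) h y v K : m != 0 -> 0 <= h ->
  m *: y = T h y + v ->
  y = m ^- K *: T (K%:R * h) y + \sum_(k < K) m ^- k.+1 *: T (k%:R * h) v.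
Proof.
move=> m0 h0 yE; elim: K => [|K ih].
  by rewrite big_ord0 mul0r (sg0 genT) expr0 invr1 scale1r addr0.
rewrite {1}ih big_ord_recr /= addrA addrAC; congr (_ + _).
have -> : T (K.+1%:R * h) y = T (K%:R * h) (T h y).
  by rewrite -natr1 mulrDl mul1r (sgD genT)// mulr_ge0.
rewrite -scalerDr -(linearD (T _)) -yE (linearZ_LR (T _)) /= scalerA.
by rewrite exprS invfM mulrAC mulVf// mul1r.
Qed.

Lemma bernoulli_ge (u : R) K : 0 <= u -> 1 + K%:R * u <= (1 + u) ^+ K.
Proof.
move=> u0; elim: K => [|K ih]; first by rewrite mul0r addr0 expr0.
rewrite exprS (@le_trans _ _ ((1 + u) * (1 + K%:R * u)))//.
  rewrite -natr1 mulrDl mul1r -subr_ge0.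
  suff -> : (1 + u) * (1 + K%:R * u) - (1 + (K%:R * u + u)) = K%:R * u ^+ 2.
    by rewrite mulr_ge0 ?sqr_ge0.
  by ring.
by rewrite ler_wpM2l// addr_ge0.
Qed.

Lemma sum_geometric (m : R) K : 1 < m ->
  \sum_(k < K) m ^- k.+1 * (m - 1) = 1 - m ^- K.
Proof.
move=> m1; have m0 : m != 0 by rewrite gt_eqF// (lt_trans ltr01).
elim: K => [|K ih]; first by rewrite big_ord0 expr0 invr1 subrr.
rewrite big_ord_recr /= ih exprS invfM mulrBr mulr1 mulrAC mulVf// mul1r.
by ring.
Qed.

(** The resolvent averages the orbit of [x] against an exponential weight, so
    it moves [x] by little when the orbit stays close to [x] for a long time
    compared with [a^-1]. *)
Lemma resolvent_close (a d M e : R) x y : 0 < a -> 0 < d -> 0 <= e -> 0 <= M ->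
  (forall t z, 0 <= t -> t <= d -> nrm (T t z) <= M * nrm z) ->
  (forall t, 0 <= t -> t <= d -> nrm (T t x - x) <= e) ->
  dom A y -> a%:C%C *: y - A y = a%:C%C *: x ->
  nrm (y - x) <= (M + 1) * nrm x / (1 + a * d) + e.
Proof.
move=> a0 d0 e0 M0 TM Te Dy yx.
have yxn : nrm y <= nrm x.
  have := dissipative_lower_bound a%:C%C dA Dy.
  by rewrite yx nrmZR /= (gtr0_norm a0) ler_pM2l.
apply: (@le_of_error _ _ _ (M / a)) => eta eta0 _.
have [d1 d10 Tx] := sg_expand genT Dy eta0.
have [n nd] := small_step d d10.
set K := n.+1 in nd; set h := d / K%:R in nd.
have h0 : 0 < h by rewrite divr_gt0.
have Kh k : (k <= K)%N -> k%:R * h <= d.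
  move=> kK; rewrite /h mulrCA; apply: ler_piMr; first exact: ltW.
  by rewrite ler_pdivrMr// mul1r ler_nat.
pose m := 1 + a * h; have m1 : 1 < m by rewrite ltrDl mulr_gt0.
have m0 : 0 < m by exact: lt_trans m1.
have mC0 : m%:C%C != 0 :> R[i] by rewrite eq_complex /= eqxx andbT gt_eqF.
pose r := T h y - y - h%:C%C *: A y.
have rh : nrm r <= h * eta by exact: Tx.
have yE : m%:C%C *: y = T h y + ((h * a)%:C%C *: x - r).
  rewrite /r !opprB rmorphM /= -scalerA -yx scalerBr scalerA -rmorphM /=.
  rewrite /m rmorphD scalerDl scale1r mulrC.
  by zmod.
clearbody r.
have KhE : K%:R * h = d by rewrite /h mulrC divfK// pnatr_eq0.
have mE k : m%:C%C ^- k = (m ^- k)%:C%C :> R[i] by rewrite fmorphV rmorphXn.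
have mm k : 0 <= m ^- k by rewrite invr_ge0 exprn_ge0// ltW.
have geo := sum_geometric K m1.
have m1E : m - 1 = h * a by rewrite /m addrAC subrr add0r mulrC.
have yxE : y - x = (m ^- K)%:C%C *: (T d y - x) +
    \sum_(k < K) (m ^- k.+1)%:C%C *:
      ((h * a)%:C%C *: (T (k%:R * h) x - x) - T (k%:R * h) r).
  have xE : x = (m ^- K)%:C%C *: x +
      \sum_(k < K) (m ^- k.+1)%:C%C *: ((h * a)%:C%C *: x).
    under eq_bigr do rewrite scalerA -rmorphM -m1E.
    rewrite -scaler_suml -rmorph_sum /= geo rmorphB /= scalerBl scale1r.
    by rewrite subrKC.
  rewrite {1}xE {1}(discrete_laplace K mC0 (ltW h0) yE) KhE mE.
  rewrite opprD addrACA -scalerBr -sumrB; congr (_ + _).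
  apply: eq_bigr => k _; rewrite mE -scalerBr; congr (_ *: _).
  by rewrite linearB (linearZ_LR (T _)) /= scalerBr; zmod.
have mK : m ^- K <= (1 + a * d)^-1.
  have ad0 : 0 < 1 + a * d by rewrite ltr_pwDl// mulr_ge0// ltW.
  rewrite lef_pV2 ?posrE ?exprn_gt0//.
  have := @bernoulli_ge (a * h) K (mulr_ge0 (ltW a0) (ltW h0)).
  by rewrite mulrCA KhE.
rewrite yxE; apply: le_trans (nrmD _ _) _; rewrite -addrA.
have Txy : nrm (T d y - x) <= (M + 1) * nrm x.
  apply: le_trans (nrmB _ _) _; rewrite mulrDl mul1r lerD2r.
  by apply: le_trans (TM _ _ (ltW d0) (lexx d)) _; rewrite ler_wpM2l.
apply: lerD.
  rewrite nrmZR ger0_norm// mulrC; apply: ler_pM => //; exact: nrm_ge0.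
apply: le_trans (nrm_sum _ _ _) _.
rewrite (@le_trans _ _ (\sum_(k < K) m ^- k.+1 * (m - 1) * (e + M / a * eta)))//.
  apply: ler_sum => k _; rewrite nrmZR ger0_norm// -mulrA.
  apply: ler_wpM2l => //; apply: le_trans (nrmB _ _) _.
  rewrite m1E nrmZR ger0_norm; last by rewrite mulr_ge0// ltW.
  have -> : h * a * (e + M / a * eta) = h * a * e + M * (h * eta).
    by field; rewrite gt_eqF.
  have kh0 : 0 <= k%:R * h by rewrite mulr_ge0// ltW.
  have khd := Kh k (ltnW (ltn_ord k)).
  apply: lerD; first by rewrite ler_wpM2l ?Te// mulr_ge0// ltW.
  by apply: le_trans (TM _ _ kh0 khd) _; rewrite ler_wpM2l.
rewrite -mulr_suml geo ler_piMl//; last by rewrite lerBlDr lerDl.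
by rewrite addr_ge0// mulr_ge0 ?divr_ge0// ltW.
Qed.

Hypothesis surjA : forall a : R, 0 < a -> onto A a%:C%C.

Lemma dom_dense x (e : R) : 0 < e -> exists2 y, dom A y & nrm (y - x) < e.
Proof.
move=> e0.
have e40 : 0 < e / 4 by rewrite divr_gt0.
have [d0 d00 dP] := sg_right_continuous genT x e40.
have [M M1 TM] := sg_bound_on genT (d0 / 2).
have d20 : 0 < d0 / 2 by rewrite divr_gt0.
have M0 : 0 <= M by exact: le_trans M1.
pose B := (M + 1) * nrm x.
have B0 : 0 <= B by rewrite mulr_ge0 ?nrm_ge0// addr_ge0.
(* makes the first term in the bound of [resolvent_close] at most [e / 4] *)
pose a := (B + 1) / (e / 4) / (d0 / 2).
have a0 : 0 < a by rewrite !divr_gt0// ltr_wpDl.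
have [y [Dy yx]] := surjA a0 (a%:C%C *: x).
exists y => //.
have := @resolvent_close a (d0 / 2) M (e / 4) x y a0 d20 (ltW e40) M0 TM.
have close t : 0 <= t -> t <= d0 / 2 -> nrm (T t x - x) <= e / 4.
  by move=> t0 td; apply: ltW; apply: dP => //; lra.
move=> /(_ close Dy yx) /le_lt_trans; apply.
have ad0 : 0 < 1 + a * (d0 / 2) by rewrite ltr_pwDl// mulr_ge0// ltW.
have Be : B / (1 + a * (d0 / 2)) <= e / 4.
  rewrite ler_pdivrMr// /a divfK ?gt_eqF//.
  rewrite mulrDr mulr1 mulrCA divff ?gt_eqF// mulr1.
  by lra.
by rewrite -/B; lra.
Qed.

(** Dissipativity makes an explicit Euler step nonexpansive up to second order
    in the step length.  The consistency error is small uniformly along the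
    orbit, being transported from time zero by the semigroup. *)
Lemma sg_contractive_dom x t : 0 <= t -> dom A x -> nrm (T t x) <= nrm x.
Proof.
rewrite le_eqVlt => /predU1P[<-|t0] Dx; first by rewrite (sg0 genT).
have [M M1 TM] := sg_bound_on genT t.
have M0 : 0 <= M by exact: le_trans M1.
pose B := M * nrm x + t * (M * nrm (A x)).
have B0 : 0 <= B by rewrite addr_ge0 ?mulr_ge0 ?nrm_ge0// ltW.
rewrite -ler_sqr ?nnegrE ?nrm_ge0//.
apply: (@le_of_error _ _ _ (t * ((M * nrm (A x)) ^+ 2 + 2 * B * M + M ^+ 2))).
move=> eta eta0 eta1.
have [d d0 dP] := sg_expand genT Dx eta0.
have min0 : 0 < Num.min d eta by rewrite lt_min d0.
have [n] := small_step t min0.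
rewrite lt_min; set h := t / n.+1%:R => /andP[hd heta].
have h0 : 0 < h by rewrite divr_gt0.
have nh : n.+1%:R * h = t by rewrite /h mulrC divfK// pnatr_eq0.
have ht : h <= t by rewrite -nh ler_peMl ?ler1n// ltW.
have step k : (k < n.+1)%N -> nrm (T (k.+1%:R * h) x) ^+ 2 <=
    nrm (T (k%:R * h) x) ^+ 2 +
    h * (eta * ((M * nrm (A x)) ^+ 2 + 2 * B * M + M ^+ 2)).
  move=> kn; have kh0 : 0 <= k%:R * h by rewrite mulr_ge0// ltW.
  have kht : k%:R * h <= t by rewrite -nh ler_pM2r// ler_nat ltnW.
  have [Du Au] := sg_dom genT kh0 Dx.
  set u := T (k%:R * h) x in Du Au *.
  have -> : T (k.+1%:R * h) x = (u + h%:C%C *: A u) +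
      T (k%:R * h) (T h x - x - h%:C%C *: A x).
    rewrite Au !(linearB (T _)) (linearZ_LR (T _)) /=.
    rewrite -(sgD genT) ?(ltW h0)// -natr1 mulrDl mul1r -/u.
    by zmod.
  set r := T (k%:R * h) _.
  have rn : nrm r <= M * (h * eta).
    by apply: le_trans (TM _ _ kh0 kht) _; rewrite ler_wpM2l// dP.
  set p := u + _.
  have Aun : nrm (A u) <= M * nrm (A x) by rewrite Au; exact: TM.
  have p2 : nrm p ^+ 2 <= nrm u ^+ 2 + h ^+ 2 * (M * nrm (A x)) ^+ 2.
    rewrite nrmD_sqr nrmZR (gtr0_norm h0) rdotZr rdotC -addrA lerD2l.
    rewrite exprMn -[leRHS]addr0 lerD//.
      by rewrite ler_wpM2l ?sqr_ge0// ler_sqr ?nnegrE ?nrm_ge0 ?mulr_ge0// nrm_ge0.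
    by rewrite !pmulr_rle0// dA.
  have pB : nrm p <= B.
    apply: le_trans (nrmD _ _) _; apply: lerD; first exact: TM.
    rewrite nrmZR (gtr0_norm h0) ler_pM ?nrm_ge0// ltW//.
  have pr : nrm (p + r) <= nrm p + M * (h * eta).
    by apply: le_trans (nrmD _ _) _; rewrite lerD2l.
  have q0 : 0 <= M * (h * eta) by rewrite !mulr_ge0// ltW.
  have : nrm (p + r) ^+ 2 <= (nrm p + M * (h * eta)) ^+ 2.
    by rewrite ler_sqr ?nnegrE ?addr_ge0 ?nrm_ge0.
  move/le_trans; apply; rewrite sqrrD -addrA.
  have c1 : h ^+ 2 * (M * nrm (A x)) ^+ 2 <= h * (eta * (M * nrm (A x)) ^+ 2).
    rewrite expr2 -mulrA ler_wpM2l ?(ltW h0)// ler_wpM2r ?sqr_ge0// ltW//.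
  have c2 : nrm p * (M * (h * eta)) *+ 2 <= h * (eta * (2 * B * M)).
    have := ler_wpM2r q0 pB; rewrite -mulr_natl.
    by move=> /(ler_wpM2l (ler0n R 2)) /le_trans; apply; rewrite le_eqVlt; apply/orP; left; apply/eqP; ring.
  have c3 : (M * (h * eta)) ^+ 2 <= h * (eta * M ^+ 2).
    have -> : (M * (h * eta)) ^+ 2 = h * (eta * M ^+ 2) * (h * eta) by ring.
    apply: ler_piMr; first by rewrite !mulr_ge0 ?sqr_ge0// ltW.
    by apply: mulr_ile1; rewrite ?(ltW h0) ?(ltW eta0) ?(ltW (lt_le_trans heta eta1)).
  by lra.
have all k : (k <= n.+1)%N -> nrm (T (k%:R * h) x) ^+ 2 <= nrm x ^+ 2 +
    k%:R * h * (eta * ((M * nrm (A x)) ^+ 2 + 2 * B * M + M ^+ 2)).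
  elim: k => [_|k ih kn]; first by rewrite !mul0r addr0 (sg0 genT).
  apply: le_trans (step k kn) _.
  have := ih (ltnW kn); rewrite -natr1 !mulrDl !mul1r; lra.
have := all n.+1 (leqnn _); rewrite nh => /le_trans; apply.
by rewrite lerD2l; lra.
Qed.

Lemma sg_contractive x t : 0 <= t -> nrm (T t x) <= nrm x.
Proof.
move=> t0; have [C C0 TC] := sg_bound genT t0.
apply: (@le_of_error _ _ _ (C + 1)) => e e0 _.
have [y Dy yx] := dom_dense x e0.
have xE : x = y + (x - y) by rewrite subrKC.
rewrite {1}xE linearD /=; apply: le_trans (nrmD _ _) _.
have := sg_contractive_dom t0 Dy; have := TC (x - y).
have := nrm_le_sub y x; rewrite (nrm_distC x y).
have := ler_wpM2l C0 (ltW yx); lra.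
Qed.

End DissipativeSemigroup.

(** * The discrete Fourier transform *)

Section Fourier.
Context {R : realType} {H : hilbertType R}.

Lemma primitive_root_exists n : (0 < n)%N ->
  exists w : R[i], n.-primitive_root w.
Proof.
move=> n0; pose p : {poly R[i]} := 'X^n - 1.
have [r Dp] := closed_field_poly_normal p.
rewrite (monicP _) ?monicXnsubC // scale1r in Dp.
have rn1 : all n.-unity_root r by apply/allP=> z; rewrite -root_prod_XsubC -Dp.
have sz_r : (n < (size r).+1)%N.
  by rewrite -(size_prod_XsubC r id) -Dp size_XnsubC.
have [|z] := hasP (has_prim_root n0 rn1 _ sz_r); last by exists z.
by rewrite -separable_prod_XsubC -Dp separable_Xn_sub_1 // pnatr_eq0 -lt0n.
Qed.

Lemma cmod_unity_root (w : R[i]) n : (0 < n)%N -> w ^+ n = 1 -> cmod w = 1.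
Proof.
move=> n0 wn; have w0 := cmod_ge0 w.
have : cmod w ^+ n = 1 by rewrite -cmodX wn (_ : 1 = 1%:C%C)// cmodR normr1.
by move/eqP; rewrite pexpr_eq1// => /eqP.
Qed.

Lemma parseval n (w : R[i]) (v : 'I_n -> H) : n.-primitive_root w ->
  \sum_(j < n) nrm (\sum_(k < n) (w ^+ j) ^+ k *: v k) ^+ 2 =
  n%:R * \sum_(k < n) nrm (v k) ^+ 2.
Proof.
move=> wn; have n0 := prim_order_gt0 wn.
have w1 := prim_expr_order wn.
have wJ : w * (w^*)%C = 1.
  by rewrite -sqr_normc cnormE (cmod_unity_root n0 w1) expr1n.
have sqrE (x : H) : ((nrm x ^+ 2)%:C)%C = '[x, x] by rewrite hdot_norm normE -rmorphXn.
apply: complexI; rewrite rmorphM !rmorph_sum /= rmorph_nat.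
under eq_bigr do rewrite sqrE linear_sumr /=.
rewrite exchange_big mulr_sumr /=; apply: eq_bigr => k _.
under eq_bigr do rewrite linear_sumlz /=.
rewrite exchange_big (bigD1 k)//= [X in _ + X]big1 ?addr0.
  under eq_bigr => j _.
    rewrite hdotZl hdotZr mulrA -!exprM rmorphXn -exprMn wJ expr1n mul1r.
    over.
  by rewrite sumr_const card_ord sqrE mulr_natl.
move=> l lk.
under eq_bigr => j _.
  rewrite hdotZl hdotZr mulrA rmorphXn rmorphXn /= -!exprM ![(j * _)%N]mulnC !exprM -exprMn.
  over.
rewrite -mulr_suml.
set z := w ^+ l * _ ^+ k.
have zn : z ^+ n = 1.
  rewrite exprMn -!exprM ![(_ * n)%N]mulnC !exprM -rmorphXn w1 expr1n.
  by rewrite rmorph1 expr1n mulr1.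
have z1 : z != 1.
  apply: contra lk => /eqP zk; rewrite -val_eqE.
  have : w ^+ l == w ^+ k.
    by rewrite -[w ^+ k]mul1r -zk /z -mulrA -exprMn mulrC [_ * w]mulrC wJ expr1n mul1r.
  by rewrite (eq_prim_root_expr wn) !modn_small.
have : (z - 1) * \sum_(j < n) z ^+ j = 0 by rewrite -subrX1 zn subrr.
by move/eqP; rewrite mulf_eq0 subr_eq0 (negPf z1) /= => /eqP ->; rewrite mul0r.
Qed.

End Fourier.

(** * From resolvent bounds to decay *)

Section Opnorm.
Context {R : realType} {U V : normedModType R[i]} (f : U -> V) (K : R).
Hypothesis fK : forall x, nrm x <= 1 -> nrm (f x) <= K.

Let ubf : ubound [set complex.Re `|f x| | x in [set x | `|x| <= 1]] K.
Proof. by move=> _ [x /= x1 <-]; apply: fK; rewrite -lecR -normE. Qed.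

Lemma opnorm_le : opnorm f <= K.
Proof. by apply: ge_sup => //; exists (nrm (f 0)), 0 => //=; rewrite normr0. Qed.

Lemma nrm_le_opnorm x : nrm x <= 1 -> nrm (f x) <= opnorm f.
Proof.
move=> x1; apply: ub_le_sup; first by exists K.
by exists x => //=; rewrite normE -[1]/(1%:C%C) lecR.
Qed.

Lemma opnorm_ge0 : 0 <= opnorm f.
Proof. by apply: le_trans (@nrm_le_opnorm 0 _); rewrite ?nrm_ge0// nrm0. Qed.

End Opnorm.

Definition tent n k := minn k (n.*2 - k).

Lemma tent_le n k : (tent n k <= n)%N.
Proof. by rewrite /tent -addnn; lia. Qed.

Lemma tent_step n k :
  (tent n k.+1 <= tent n k + 1 /\ tent n k <= tent n k.+1 + 1)%N.
Proof. by rewrite /tent -addnn; split; lia. Qed.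

Lemma tent_id n k : (k <= n)%N -> tent n k = k.
Proof. by rewrite /tent -addnn => kn; lia. Qed.

Section Gearhart.
Context {R : realType} {H : hilbertType R} {A : operator H H}.
Context {c : R} (c0 : 0 < c).
Hypothesis lbA : forall l, 0 <= complex.Re l -> lower_bound A l c.

Lemma fourier_lower_bound (w : nat -> H) (tau : R) N (z : R[i]) : 0 < tau ->
  (forall k, dom A (w k)) -> w 0 = 0 -> w N = 0 -> cmod z = 1 ->
  tau * c * nrm (\sum_(k < N) z ^+ k *: w k) <=
  nrm (\sum_(k < N) z ^+ k *: (w k.+1 - tau%:C%C *: A (w k.+1) - w k)).
Proof.
move=> tau0 Dw w0 wN z1.
set W := \sum_(k < N) z ^+ k *: w k.
have WE : \sum_(k < N) z ^+ k.+1 *: w k.+1 = W.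
  have E : \sum_(k < N.+1) z ^+ k *: w k = W by rewrite big_ord_recr /= wN scaler0 addr0.
  by rewrite -E big_ord_recl /= w0 scaler0 add0r.
have DW : dom A W by apply: dom_sum => k; exact: domZ.
have AW : A W = \sum_(k < N) z ^+ k.+1 *: A (w k.+1).
  rewrite -WE op_sum; last by move=> k; exact: domZ.
  by apply: eq_bigr => k _; rewrite opZ.
pose l := (1 - z) / tau%:C%C.
have tC0 : tau%:C%C != 0 :> R[i] by rewrite eq_complex /= eqxx andbT gt_eqF.
have l0 : 0 <= complex.Re l.
  rewrite /l -fmorphV; have := Re_le_cmod z; rewrite z1 ler_norml => /andP[_].
  case: (z) => p q /= p1; rewrite mulr0 subr0.
  by apply: mulr_ge0; rewrite ?subr_ge0 ?invr_ge0 ?(ltW tau0).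
have := lbA l0 DW; rewrite -(ler_pM2l tau0) mulrA => /le_trans; apply.
rewrite -[X in X * nrm (_ - _)](gtr0_norm tau0) -nrmZR scalerBr scalerA mulrC divfK//.
rewrite -[leRHS]mul1r -z1 -nrmZ.
suff -> : (1 - z) *: W - tau%:C%C *: A W =
    z *: \sum_(k < N) z ^+ k *: (w k.+1 - tau%:C%C *: A (w k.+1) - w k) by [].
rewrite scalerBl scale1r -{1}WE AW !scaler_sumr addrAC -!sumrB.
apply: eq_bigr => k _.
by rewrite !scalerBr !scalerA -!exprS [tau%:C%C * _]mulrC.
Qed.

(** Transforming in the discrete time variable turns the backward difference
    operator into multiplication by [(1 - z) / tau], a number of nonnegative
    real part, so the resolvent bound applies frequency by frequency. *)
Lemma discrete_regularity (w : nat -> H) (tau : R) N : 0 < tau -> (0 < N)%N ->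
  (forall k, dom A (w k)) -> w 0 = 0 -> w N = 0 ->
  (tau * c) ^+ 2 * \sum_(k < N) nrm (w k) ^+ 2 <=
  \sum_(k < N) nrm (w k.+1 - tau%:C%C *: A (w k.+1) - w k) ^+ 2.
Proof.
move=> tau0 N0 Dw w0 wN; have [z zN] := primitive_root_exists (R := R) N0.
have N0' : 0 < N%:R :> R by rewrite ltr0n.
rewrite -(ler_pM2l N0') mulrCA.
rewrite -(parseval (fun k : 'I_N => w k) zN).
rewrite -(parseval (fun k : 'I_N => w k.+1 - tau%:C%C *: A (w k.+1) - w k) zN).
rewrite mulr_sumr; apply: ler_sum => j _.
rewrite -exprMn ler_sqr ?nnegrE ?nrm_ge0//; last first.
  by rewrite !mulr_ge0 ?nrm_ge0// ltW.
apply: fourier_lower_bound => //.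
by rewrite cmodX (cmod_unity_root N0 (prim_expr_order zN)) expr1n.
Qed.

Context {T : R -> {linear H -> H}} (genT : generates A T).
Hypothesis contrT : forall (t : R) x, 0 <= t -> nrm (T t x) <= nrm x.

Lemma sum_sqr_ge n : n%:R ^+ 3 / 3 <= \sum_(k < n.+1) (k%:R : R) ^+ 2.
Proof.
elim: n => [|n ih]; first by rewrite big_ord1 expr0n /= expr0n mul0r.
rewrite big_ord_recr /=; apply: (le_trans _ (lerD ih (lexx _))).
have n0 : 0 <= n%:R :> R by [].
rewrite -natr1 -subr_ge0.
suff -> : n%:R ^+ 3 / 3 + (n%:R + 1) ^+ 2 - (n%:R + 1) ^+ 3 / 3 =
  n%:R + 2 / 3 :> R by rewrite addr_ge0.
by field.
Qed.

(** The orbit is cut off by a tent function of slope [1 / t]; monotonicity of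
    the norm along the orbit turns the resulting integral inequality into a
    pointwise one. *)
Lemma sg_decay_dom x t : 0 < t -> dom A x ->
  nrm (T t x) <= 3 / (c * t) * nrm x.
Proof.
move=> t0 Dx.
(* [6] compares the number [2 n] of grid points with the lower bound [n / 3]
   for the sum of the squares of the tent function *)
suff le2 : (c * t * nrm (T t x)) ^+ 2 <= 6 * nrm x ^+ 2.
  rewrite mulrAC ler_pdivlMr ?mulr_gt0// mulrC.
  rewrite -ler_sqr ?nnegrE ?mulr_ge0 ?nrm_ge0 ?(ltW c0) ?(ltW t0)//.
  apply: le_trans le2 _; rewrite exprMn ler_wpM2r ?sqr_ge0//.
  by rewrite -natrX ler_nat.
pose K := 6 * (2 * nrm x * t + t ^+ 2).
apply: (@le_of_error _ _ _ K) => eta eta0 eta1.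
have eta20 : 0 < eta / 2 by rewrite divr_gt0.
have [d1 d10 d1P] := sg_expand genT Dx eta20.
have [d2 d20 d2P] := sg_right_continuous genT (A x) eta20.
have min0 : 0 < Num.min d1 d2 by rewrite lt_min d10.
have [n0] := small_step t min0; set n := n0.+1.
rewrite lt_min; set tau := t / n%:R => /andP[taud1 taud2].
have tau0 : 0 < tau by rewrite divr_gt0.
have ntau : n%:R * tau = t by rewrite /tau mulrC divfK// pnatr_eq0.
have nR : 0 < n%:R :> R by rewrite ltr0n.
pose u k := T (k%:R * tau) x.
have kt0 k : 0 <= k%:R * tau by rewrite mulr_ge0// ltW.
have Du k : dom A (u k) by have [] := sg_dom genT (kt0 k) Dx.
pose chi k : R := (tent n k)%:R / n%:R.
pose w k := (chi k)%:C%C *: u k.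
have Dw k : dom A (w k) by exact: domZ.
have w0 : w 0 = 0 by rewrite /w /chi /tent min0n mul0r scale0r.
have wN : w n.*2 = 0 by rewrite /w /chi /tent subnn minn0 mul0r scale0r.
have N0 : (0 < n.*2)%N by rewrite double_gt0.
have := discrete_regularity tau0 N0 Dw w0 wN.
have chi1 k : 0 <= chi k <= 1.
  rewrite /chi divr_ge0//= ler_pdivrMr// mul1r ler_nat.
  exact: tent_le.
have dchi k : `|chi k.+1 - chi k| <= n%:R^-1.
  rewrite /chi -mulrBl normrM [`|n%:R^-1|]gtr0_norm ?invr_gt0//; apply: ler_piMl.
    by rewrite invr_ge0 ltW.
  have [le1 le2] := tent_step n k.
  have := le1; rewrite -(ler_nat R) natrD => ?.
  have := le2; rewrite -(ler_nat R) natrD => ?.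
  by rewrite ler_norml; lra.
have err k : nrm (u k.+1 - tau%:C%C *: A (u k.+1) - u k) <= tau * eta.
  have [_ Au] := sg_dom genT (kt0 k.+1) Dx.
  have uS v : T (k.+1%:R * tau) v = T (k%:R * tau) (T tau v).
    by rewrite -natr1 mulrDl mul1r (sgD genT)// ltW.
  have -> : u k.+1 - tau%:C%C *: A (u k.+1) - u k = T (k%:R * tau)
      ((T tau x - x - tau%:C%C *: A x) - tau%:C%C *: (T tau (A x) - A x)).
    rewrite /u Au !uS !(linearB (T _)) !(linearZ_LR (T _)) /= !(linearB (T _)).
    by rewrite /= scalerBr; zmod.
  apply: le_trans (contrT _ (kt0 k)) _; apply: le_trans (nrmB _ _) _.
  rewrite nrmZR (gtr0_norm tau0).
  have e1 := d1P _ tau0 taud1; have e2 := d2P _ (ltW tau0) taud2.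
  have := ler_wpM2l (ltW tau0) (ltW e2); lra.
pose g := tau * eta + n%:R^-1 * nrm x.
have gk k : nrm (w k.+1 - tau%:C%C *: A (w k.+1) - w k) <= g.
  have -> : w k.+1 - tau%:C%C *: A (w k.+1) - w k =
      (chi k.+1)%:C%C *: (u k.+1 - tau%:C%C *: A (u k.+1) - u k) +
      (chi k.+1 - chi k)%:C%C *: u k.
    rewrite /w opZ// rmorphB /= !scalerBr scalerBl !scalerA [tau%:C%C * _]mulrC.
    by zmod.
  have /andP[c1 c2] := chi1 k.+1.
  apply: le_trans (nrmD _ _) _; rewrite !nrmZR; apply: lerD.
    rewrite (ger0_norm c1) -[leRHS]mul1r; apply: ler_pM => //; exact: nrm_ge0.
  apply: ler_pM => //; first exact: nrm_ge0.
  exact: contrT.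
have g0 : 0 <= g by apply: le_trans (gk 0); exact: nrm_ge0.
have up : \sum_(k < n.*2) nrm (w k.+1 - tau%:C%C *: A (w k.+1) - w k) ^+ 2 <=
    n.*2%:R * g ^+ 2.
  rewrite mulr_natl -[X in _ <= _ *+ X]card_ord -sumr_const.
  by apply: ler_sum => k _; rewrite ler_sqr ?nnegrE ?nrm_ge0.
have uT k : (k <= n)%N -> nrm (T t x) <= nrm (u k).
  move=> kn; have kt : 0 <= t - k%:R * tau.
    by rewrite subr_ge0 -ntau ler_pM2r// ler_nat.
  have -> : T t x = T (t - k%:R * tau) (u k) by rewrite -(sgD genT)// subrK.
  exact: contrT.
have lo : n%:R / 3 * nrm (T t x) ^+ 2 <= \sum_(k < n.*2) nrm (w k) ^+ 2.
  have nn : (n.+1 <= n.*2)%N by rewrite -addnn /n addnS ltnS leq_addr.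
  rewrite -(big_mkord xpredT (fun k => nrm (w k) ^+ 2)).
  rewrite (big_cat_nat (leq0n n.+1) nn)//= -[leLHS]addr0; apply: lerD; last first.
    by apply: sumr_ge0 => k _; rewrite sqr_ge0.
  rewrite big_mkord; apply: (@le_trans _ _
    (\sum_(k < n.+1) k%:R ^+ 2 * (n%:R ^- 2 * nrm (T t x) ^+ 2))).
    rewrite -mulr_suml mulrA ler_wpM2r ?sqr_ge0//.
    apply: le_trans (ler_wpM2r _ (sum_sqr_ge n)); last by rewrite invr_ge0 sqr_ge0.
    rewrite le_eqVlt; apply/orP; left; apply/eqP; field.
    by rewrite gt_eqF.
  apply: ler_sum => k _; have kn : (k <= n)%N by rewrite -ltnS.
  rewrite /w nrmZR exprMn mulrA; apply: ler_pM.
  - by rewrite mulr_ge0 ?sqr_ge0// invr_ge0 sqr_ge0.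
  - exact: sqr_ge0.
  - have -> : chi k = k%:R / n%:R.
      by rewrite /chi tent_id.
    by rewrite real_normK ?num_real// exprMn exprVn.
  - by rewrite ler_sqr ?nnegrE ?nrm_ge0// uT.
move=> /le_trans /(_ up).
have t2c : 0 <= (tau * c) ^+ 2 by rewrite sqr_ge0.
have := ler_wpM2l t2c lo => /le_trans /[apply].
have gE : g = (t * eta + nrm x) / n%:R.
  by rewrite /g /tau; field; rewrite gt_eqF.
rewrite gE /tau -addnn natrD => le6.
have n30 : 0 < 3 * n%:R :> R by rewrite mulr_gt0.
have := ler_wpM2l (ltW n30) le6.
have -> : 3 * n%:R * ((t / n%:R * c) ^+ 2 * (n%:R / 3 * nrm (T t x) ^+ 2)) =
    (c * t * nrm (T t x)) ^+ 2 by field; rewrite gt_eqF.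
have -> : 3 * n%:R * ((n%:R + n%:R) * ((t * eta + nrm x) / n%:R) ^+ 2) =
    6 * (t * eta + nrm x) ^+ 2 by field; rewrite gt_eqF.
move=> /le_trans; apply.
have -> : 6 * nrm x ^+ 2 + K * eta =
  6 * (t * eta + nrm x) ^+ 2 + 6 * t ^+ 2 * (eta - eta ^+ 2) by rewrite /K; ring.
rewrite lerDl; apply: mulr_ge0; first by rewrite mulr_ge0 ?sqr_ge0.
by rewrite subr_ge0 expr2 ler_piMr// ltW.
Qed.

Hypothesis denseA : forall x (e : R), 0 < e -> exists2 y, dom A y & nrm (y - x) < e.

Lemma sg_decay x t : 0 < t -> nrm (T t x) <= 3 / (c * t) * nrm x.
Proof.
move=> t0; have k0 : 0 <= 3 / (c * t) by rewrite divr_ge0// ltW// mulr_gt0.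
apply: (@le_of_error _ _ _ (3 / (c * t) + 1)) => e e0 _.
have [y Dy yx] := denseA x e0.
have xE : x = y + (x - y) by rewrite subrKC.
rewrite {1}xE linearD /=; apply: le_trans (nrmD _ _) _.
have := sg_decay_dom t0 Dy; have := contrT (x - y) (ltW t0).
have := ler_wpM2l k0 (nrm_le_sub y x).
have := ler_wpM2l k0 (ltW yx); rewrite (nrm_distC x y); lra.
Qed.

Lemma gearhart_exponentially_stable : exponentially_stable T.
Proof.
have opT t : 0 < t -> 0 <= opnorm (T t) <= 3 / (c * t).
  move=> t0; have Tt x : nrm x <= 1 -> nrm (T t x) <= 3 / (c * t).
    move=> x1; apply: le_trans (sg_decay x t0) _.
    by rewrite ler_piMr// divr_ge0// ltW// mulr_gt0.
  by rewrite (opnorm_ge0 Tt) opnorm_le.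
apply/cvgrPdist_lt => e e0; near=> t.
have t0 : 0 < t by near: t; exact: nbhs_pinfty_gt.
have /andP[ge0 le3] := opT t t0.
rewrite sub0r normrN ger0_norm//; apply: le_lt_trans le3 _.
rewrite ltr_pdivrMr ?mulr_gt0// mulrA -ltr_pdivrMl ?mulr_gt0//.
by near: t; apply: nbhs_pinfty_gt; rewrite num_real.
Unshelve. all: by end_near. Qed.

End Gearhart.

(** * The coupled system *)

Lemma contractive_dissipative (R : realType) (H : hilbertType R)
    (B : operator H H) (T : R -> {linear H -> H}) :
  generates B T -> contractive T -> dissipative B.
Proof.
move=> genT contrT x Dx.
apply: (@le_of_error _ _ _ (nrm x)) => eta eta0 _; rewrite add0r.
have [d d0 dP] := sg_expand genT Dx eta0.
have [n] := small_step 1 d0; set h := 1 / n.+1%:R => hd.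
have h0 : 0 < h by rewrite divr_gt0.
have Tx : nrm (T h x) <= nrm x by rewrite -lecR -!normE contrT// ltW.
have := dP _ h0 hd; set r := _ - _ => rh.
rewrite -(ler_pM2l h0) -rdotZl.
have -> : h%:C%C *: B x = T h x - x - r by rewrite /r; zmod.
rewrite rdotDl rdotDl !rdotNl rdotxx.
have := rdot_le (T h x) x; have := rdot_ge r x.
have := ler_wpM2r (nrm_ge0 x) Tx; have := ler_wpM2r (nrm_ge0 x) rh.
lra.
Qed.

(** Lax-Milgram: for a suitable step size the relaxation
    [x - rho (L x - y)] contracts. *)
Lemma coercive_solvable (R : realType) (H : hilbertType R) (L : {linear H -> H})
    (C nu : R) : 0 < nu -> (forall x, nrm (L x) <= C * nrm x) ->
  (forall x, nu * nrm x ^+ 2 <= rdot x (L x)) -> forall y, exists x, L x = y.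
Proof.
move=> nu0 LC Lnu y.
pose D := Num.max C nu.
have D0 : 0 < D by rewrite lt_max nu0 orbT.
have LD x : nrm (L x) <= D * nrm x.
  by apply: le_trans (LC x) _; rewrite ler_wpM2r ?nrm_ge0// le_max lexx.
(* the step size minimizing [1 - 2 rho nu + rho ^ 2 D ^ 2] *)
pose rho := nu / D ^+ 2.
have rho0 : 0 < rho by rewrite divr_gt0// exprn_gt0.
pose q2 := 1 - nu ^+ 2 / D ^+ 2.
have q20 : 0 <= q2.
  rewrite subr_ge0 ler_pdivrMr ?exprn_gt0// mul1r.
  by rewrite ler_sqr ?nnegrE ?(ltW nu0) ?(ltW D0)// le_max lexx orbT.
have q21 : Num.sqrt q2 < 1.
  rewrite -sqrtr1 ltr_sqrt// gtrBl divr_gt0// exprn_gt0//.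
have [x z|x /= xE] := @contraction_fixpoint R H
  (fun x => x - rho%:C%C *: (L x - y)) (Num.sqrt q2) (sqrtr_ge0 _) q21.
  have -> : x - rho%:C%C *: (L x - y) - (z - rho%:C%C *: (L z - y)) =
      (x - z) + - (rho%:C%C *: L (x - z)).
    by rewrite (linearB L) /= !scalerBr; zmod.
  rewrite -ler_sqr ?nnegrE ?mulr_ge0 ?nrm_ge0 ?sqrtr_ge0//.
  rewrite exprMn sqr_sqrtr// nrmD_sqr nrmN rdotNr rdotZr nrmZR (gtr0_norm rho0).
  set v := x - z.
  have vn := nrm_ge0 v; have Lvn := nrm_ge0 (L v).
  have h1 : (rho * nrm (L v)) ^+ 2 <= rho ^+ 2 * (D * nrm v) ^+ 2.
    rewrite exprMn ler_wpM2l ?sqr_ge0// ler_sqr ?nnegrE ?mulr_ge0 ?(ltW D0)//.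
  have h2 := ler_wpM2l (ltW rho0) (Lnu v).
  have -> : q2 * nrm v ^+ 2 = nrm v ^+ 2 + rho ^+ 2 * (D * nrm v) ^+ 2 +
      2 * - (rho * (nu * nrm v ^+ 2)).
    by rewrite /q2 /rho; field; rewrite gt_eqF.
  by lra.
exists x; apply/subr0_eq.
have : rho%:C%C *: (L x - y) = 0.
  by apply: oppr_inj; apply: (addrI x); rewrite oppr0 addr0 -xE.
move/eqP; rewrite scaler_eq0 => /orP[|/eqP//].
by rewrite eq_complex /= eqxx andbT gt_eqF.
Qed.

Section System.
Context {R : realType} {H1 H2 : hilbertType R}.
Context {A1 : operator (hprod H1 H2) H1} {A21 : operator H1 H2}.
Context {S : {linear H2 -> H2}}.
Context (S_bounded : bounded_op S) {nu : R} (nu0 : 0 < nu).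
Hypothesis S_coercive : forall g, nu * nrm g ^+ 2 <= rdot g (S g).
Hypothesis dAext : dissipative (Aext A1 A21).
Hypothesis resAext : forall s : R, resolvent_set (Aext A1 A21) (Complex 0 s).
Local Notation AS := (AS A1 A21 S).

Lemma AS_energy h : dom AS h -> rdot (AS h) h <= - (nu * nrm (A21 h) ^+ 2).
Proof.
move=> [D21 D1].
have Dx : dom (Aext A1 A21) (h, S (A21 h)) by split.
have -> : AS h = A1 (h, S (A21 h)) by [].
have := dAext Dx; rewrite prod_rdot /=.
by have := S_coercive (A21 h); lra.
Qed.

Lemma AS_dissipative : dissipative AS.
Proof.
move=> h Dh; apply: le_trans (AS_energy Dh) _.
by rewrite oppr_le0 mulr_ge0 ?sqr_ge0// ltW.
Qed.

Lemma AS_A21_bound s h : dom AS h ->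
  nu * nrm (A21 h) ^+ 2 <= nrm (Complex 0 s *: h - AS h) * nrm h.
Proof.
move=> Dh; apply: le_trans (rdot_le _ _).
rewrite rdotDl rdotNl rdot_selfZ /= mul0r add0r.
by have := AS_energy Dh; lra.
Qed.

(** The feedback equation is a perturbation of the equation for the extended
    operator; the perturbation only sees [A21 h], which the energy inequality
    controls by the geometric mean of the residual and of [h]. *)
Lemma AS_lower_bound s : exists2 c : R, 0 < c & lower_bound AS (Complex 0 s) c.
Proof.
have [B [/bounded_opP[M M0 BM] _ BA]] := resAext s.
have [C C0 SC] := bounded_opP S_bounded.
pose K := M * (`|s| * C + 1).
have K0 : 0 <= K by rewrite mulr_ge0// addr_ge0// mulr_ge0.
(* each of the two terms of [hle] below is then at most [nrm h / 4] *)
pose c := Num.min (4 * (M + 1))^-1 (nu / (16 * (K ^+ 2 + 1))).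
have K1 : 0 < K ^+ 2 + 1 by rewrite ltr_wpDl// sqr_ge0.
have M1 : 0 < M + 1 by rewrite ltr_wpDl.
have c0 : 0 < c by rewrite lt_min invr_gt0 divr_gt0// !mulr_gt0.
exists c => // h Dh; rewrite leNgt; apply/negP.
set f := _ - _ => fh.
have [D21 D1] := Dh.
pose x : hprod H1 H2 := (h, S (A21 h)).
have Dx : dom (Aext A1 A21) x by split.
have hle : nrm h <= M * nrm f + K * nrm (A21 h).
  apply: le_trans (prod_fst_le x) _; rewrite -[x in leLHS](BA x Dx).
  apply: le_trans (BM _) _; rewrite /K -mulrA -mulrDr ler_wpM2l//.
  apply: le_trans (prod_nrm_le _) _; apply: lerD => //=.
  apply: le_trans (nrmB _ _) _; rewrite mulrDl mul1r lerD2r nrmZ -mulrA.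
  apply: ler_pM; rewrite ?cmod_ge0 ?nrm_ge0//.
  by rewrite /cmod normc_def /= expr0n add0r sqrtr_sqr.
have gle := AS_A21_bound s Dh; rewrite -/f in gle.
have hn := nrm_ge0 h; have fn := nrm_ge0 f; have gn := nrm_ge0 (A21 h).
have c1 : c * (4 * (M + 1)) <= 1.
  by rewrite -ler_pdivlMr ?mulr_gt0// div1r ge_min lexx.
have c2 : c * (16 * (K ^+ 2 + 1)) <= nu.
  by rewrite -ler_pdivlMr ?mulr_gt0// ge_min lexx orbT.
have Mf : M * nrm f <= nrm h / 4.
  have : M * nrm f <= M * (c * nrm h) by rewrite ler_wpM2l// ltW.
  have : c * nrm h * 4 * (M + 1) <= nrm h.
    by have := ler_wpM2r hn c1; lra.
  have := mulr_ge0 (ltW c0) hn; lra.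
have Kg : K * nrm (A21 h) <= nrm h / 4.
  have l0 : 0 <= K * nrm (A21 h) by rewrite mulr_ge0.
  have r0 : 0 <= nrm h / 4 by rewrite divr_ge0.
  rewrite -ler_sqr ?nnegrE// exprMn.
  have gh : nu * nrm (A21 h) ^+ 2 <= c * nrm h ^+ 2.
    apply: le_trans gle _; rewrite expr2 mulrA ler_wpM2r// ltW//.
  rewrite -(ler_pM2l nu0) mulrCA.
  apply: le_trans (ler_wpM2l (sqr_ge0 K) gh) _.
  have := ler_wpM2r (sqr_ge0 (nrm h)) c2.
  have := mulr_ge0 (ltW c0) (sqr_ge0 (nrm h)).
  rewrite expr_div_n (_ : 4 ^+ 2 = 16 :> R); last by rewrite -natrX.
  lra.
have hz : nrm h = 0 by lra.
by move: fh; rewrite hz mulr0; lra.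
Qed.

Lemma AS_lower_bound_compact b :
  exists2 c : R, 0 < c &
    forall s, `|s| <= b -> lower_bound AS (Complex 0 s) c.
Proof.
have : compact `[- b, b] by exact: segment_compact.
move/compact_near_coveringP/(_ R 0^'+ (fun c s => lower_bound AS (Complex 0 s) c)).
case.
  move=> s _; have [c c0 lb] := AS_lower_bound s.
  exists ([set s' | `|s - s'| < c / 2], [set c' | c' < c / 2]).
    split; first by apply/nbhs_ballP; exists (c / 2); rewrite /= ?divr_gt0// -ball_normE.
    by apply: nbhs_right_lt; rewrite divr_gt0.
  move=> [s' c'] /= [ss' cc']; apply: lower_bound_weaken (lower_bound_shift _ lb).
  have -> : Complex 0 s' - Complex 0 s = Complex 0 (s' - s) :> R[i].
    by apply/eqP; rewrite eq_complex /= subrr !eqxx.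
  rewrite /cmod normc_def /= expr0n add0r sqrtr_sqr distrC; lra.
move=> d /= d0 dP; exists (d / 2); first by rewrite divr_gt0.
move=> s sb; apply: (dP (d / 2)).
- by rewrite /= sub0r normrN gtr0_norm ?divr_gt0// ltr_pdivrMr// ltr_pMr// ltr1n.
- by rewrite divr_gt0.
- by rewrite /= in_itv /= -ler_norml.
Qed.

(** With [B] the inverse of the negated extended operator, solving for [h]
    amounts to solving [S g + B_22 g = B_21 f] for [g = A21 h]; the corner
    [B_22] is accretive, so the left side is coercive. *)
Lemma AS_onto0 : onto AS 0.
Proof.
move=> f; have [B [/bounded_opP[M M0 BM] BR _]] := resAext 0.
have [C C0 SC] := bounded_opP S_bounded.
have BE y : Aext A1 A21 (B y) = - y.
  have [_ yE] := BR y; rewrite (_ : Complex 0 0 = 0 :> R[i])// in yE.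
  by rewrite -[X in _ = - X]yE scale0r sub0r opprK.
have DB y : dom (Aext A1 A21) (B y) by have [] := BR y.
pose in2 (g : H2) : hprod H1 H2 := (0, g).
have in2L : linear in2.
  move=> a x y; transitivity ((a *: 0 + 0, a *: x + y) : hprod H1 H2) => //.
  by rewrite scaler0 addr0.
pose L g := S g + (B (in2 g)).2.
have linL : linear L.
  move=> a x y; rewrite /L linearP in2L linearP /= scalerDr.
  by rewrite addrACA.
pose L' : {linear H2 -> H2} := HB.pack L (GRing.isLinear.Build _ _ _ _ _ linL).
have in2n g : nrm (in2 g) <= nrm g.
  by apply: le_trans (prod_nrm_le _) _; rewrite /= nrm0 add0r.
have LC g : nrm (L' g) <= (C + M) * nrm g.
  apply: le_trans (nrmD _ _) _; rewrite mulrDl lerD//.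
  apply: le_trans (prod_snd_le _) _; apply: le_trans (BM _) _.
  by rewrite ler_wpM2l.
have Lnu g : nu * nrm g ^+ 2 <= rdot g (L' g).
  rewrite rdotDr -[leLHS]addr0; apply: lerD => //.
  have := dAext (DB (in2 g)); rewrite BE rdotNl oppr_le0 prod_rdot /=.
  by rewrite [rdot 0 _]/rdot linear0l /= add0r.
have [g Lg] := coercive_solvable nu0 LC Lnu (B (f, 0)).2.
pose x := B (f, - g).
have x2 : x.2 = S g.
  rewrite (_ : S g = (B (f, 0)).2 - (B (in2 g)).2); last first.
    by rewrite -Lg /= /L addrK.
  rewrite /x (_ : (f, - g) = (f, 0) - in2 g :> hprod H1 H2) ?linearB//.
  transitivity ((f - 0, 0 - g) : hprod H1 H2) => //.
  by rewrite subr0 sub0r.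
have xE : Aext A1 A21 x = (- f, g).
  rewrite BE; transitivity ((- f, - - g) : hprod H1 H2) => //.
  by rewrite opprK.
have A1x : A1 x = - f by have := congr1 fst xE.
have A21x : A21 x.1 = g by have := congr1 snd xE.
have [D1 D21] := DB (f, - g); rewrite -/x in D1 D21.
have xx : x = (x.1, S (A21 x.1)) by rewrite A21x -x2; case: (x).
exists x.1; split; first by split => //; rewrite -xx.
have ASx : AS x.1 = A1 x by exact: (congr1 A1 (esym xx)).
by rewrite scale0r sub0r ASx A1x opprK.
Qed.

Lemma AS_onto a : 0 <= a -> onto AS a%:C%C.
Proof.
move=> a0; have [c c0 lb] := AS_lower_bound 0.
exact: (onto_pos c0 AS_dissipative lb AS_onto0).
Qed.

Context {T : R -> {linear H1 -> H1}} (AS_gen : generates AS T).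

Lemma AS_dense x (e : R) : 0 < e -> exists2 y, dom AS y & nrm (y - x) < e.
Proof.
by apply: (dom_dense AS_gen AS_dissipative) => a a0; apply: AS_onto; exact: ltW.
Qed.

Lemma AS_contractive x t : 0 <= t -> nrm (T t x) <= nrm x.
Proof.
apply: (sg_contractive AS_gen AS_dissipative) => a a0.
by apply: AS_onto; exact: ltW.
Qed.

Lemma high_frequency_stable (b c : R) : 0 < c ->
  (forall s, b <= `|s| -> lower_bound AS (Complex 0 s) c) ->
  exponentially_stable T.
Proof.
move=> c0 hi; have [c' c'0 lo] := AS_lower_bound_compact b.
pose m := Num.min c c'.
have m0 : 0 < m by rewrite lt_min c0.
have lb s : lower_bound AS (Complex 0 s) m.
  have [sb|bs] := leP `|s| b.
    by apply: lower_bound_weaken (lo s sb); rewrite ge_min lexx orbT.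
  by apply: lower_bound_weaken (hi s (ltW bs)); rewrite ge_min lexx.
have m20 : 0 < m / 2 by rewrite divr_gt0.
apply: (gearhart_exponentially_stable m20 _ AS_gen).
- exact: dissipative_half_plane AS_dissipative lb.
- by move=> t x; exact: AS_contractive.
- by move=> x e; exact: AS_dense.
Qed.

End System.

(** * High frequencies: compactness and norm continuity *)

Section HighFrequency.
Context {R : realType} {H : hilbertType R} {A : operator H H}.

Lemma lower_bound_unit l (c : R) :
  (forall y, dom A y -> nrm y = 1 -> c <= nrm (l *: y - A y)) ->
  lower_bound A l c.
Proof.
move=> lb y Dy; have [y0|y0] := eqVneq (nrm y) 0.
  by rewrite y0 mulr0 nrm_ge0.
have yn : 0 < nrm y by rewrite lt_neqAle eq_sym y0 nrm_ge0.
have := lb ((nrm y)^-1%:C%C *: y) (domZ _ Dy).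
have cn x : nrm ((nrm y)^-1%:C%C *: (x : H)) = nrm x / nrm y.
  by rewrite nrmZR ger0_norm ?invr_ge0 ?nrm_ge0// mulrC.
rewrite opZ// scalerA mulrC -scalerA -scalerBr !cn divff// => /(_ erefl).
by rewrite ler_pdivlMr.
Qed.

Lemma cmod_imag (s : R) : cmod (Complex 0 s) = `|s|.
Proof. by rewrite /cmod normc_def /= expr0n add0r sqrtr_sqr. Qed.

(** On the part of a compact set that stays away from the origin the inverse of
    [A], being injective, is bounded below; but it maps an approximate
    eigenvector of frequency [s] to a vector of order [1 / s]. *)
Lemma compact_high_frequency (K : set H) (c : R) : 0 < c ->
  lower_bound A 0 c -> onto A 0 -> precompact K ->
  exists b : R, forall s y, b <= `|s| -> dom A y -> K y ->
    4^-1 <= nrm y -> nrm y <= 1 -> 1 <= nrm (Complex 0 s *: y - A y).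
Proof.
move=> c0 lb surj; rewrite precompactE => Kc.
have [B BP] := choice surj.
have DB g : dom A (B g) by case: (BP g).
have BE g : A (B g) = - g.
  by case: (BP g) => _; rewrite scale0r sub0r => {2}<-; rewrite opprK.
have Ble x : dom A x -> c * nrm x <= nrm (A x).
  by move=> Dx; have := lb x Dx; rewrite scale0r sub0r nrmN.
have Blip g g' : c * nrm (B g - B g') <= nrm (g - g').
  apply: le_trans (Ble _ (domB (DB g) (DB g'))) _.
  by rewrite opB// !BE -opprD nrmN.
have B_eq0 x : B x = 0 -> x = 0.
  by move=> Bx; have := BE x; rewrite Bx op0 => /esym/eqP; rewrite oppr_eq0 => /eqP.
have [m m0 mP] : exists2 m : R, 0 < m & forall x, closure K x ->
    4^-1 <= nrm x -> m <= nrm (B x).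
  move/compact_near_coveringP/(_ R 0^'+
    (fun m x => 4^-1 <= nrm x -> m <= nrm (B x))) : Kc; case.
    move=> x _.
    have [Bx|Bx] := eqVneq (B x) 0.
      have x0 := B_eq0 _ Bx.
      exists ([set x' | nrm (x' - x) < 4^-1], setT).
        split; last exact: filterT.
        by have /cvg_nrmP := @cvg_id _ (nbhs x); apply; rewrite invr_gt0.
      by move=> [x' m] /= [+ _]; rewrite x0 subr0 ltNge => /negP.
    have Bxn : 0 < nrm (B x).
      by rewrite lt_neqAle nrm_ge0 andbT; apply: contra_neq Bx => /esym/nrm_eq0.
    exists ([set x' | nrm (x' - x) < c * (nrm (B x) / 2)], [set m | m < nrm (B x) / 2]).
      split; last by apply: nbhs_right_lt; rewrite divr_gt0.
      by have /cvg_nrmP := @cvg_id _ (nbhs x); apply; rewrite mulr_gt0// divr_gt0.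
    move=> [x' m] /= [xx' mB] _.
    have : nrm (B x' - B x) < nrm (B x) / 2.
      by rewrite -(ltr_pM2l c0); exact: le_lt_trans (Blip _ _) xx'.
    have := nrm_le_sub (B x) (B x'); rewrite nrm_distC; lra.
  move=> d /= d0 dP; exists (d / 2); first by rewrite divr_gt0.
  move=> x Kx; apply: (dP (d / 2)) => //.
  - by rewrite /= sub0r normrN gtr0_norm ?divr_gt0// ltr_pdivrMr// ltr_pMr// ltr1n.
  - by rewrite divr_gt0.
exists ((1 + c^-1) / m + 1) => s y bs Dy Ky y1 y2.
rewrite leNgt; apply/negP; set f := _ - _ => f1.
have mB := mP y (subset_closure Ky) y1.
have uE : Complex 0 s *: B y + y = B f.
  apply/subr0_eq/nrm_eq0/le_anti; rewrite nrm_ge0 andbT -(ler_pM2l c0) mulr0.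
  have Du : dom A (Complex 0 s *: B y + y) by apply: domD => //; exact: domZ.
  apply: le_trans (Ble _ (domB Du (DB f))) _.
  rewrite opB// opD//; last exact: domZ.
  rewrite opZ//; have -> : Complex 0 s *: A (B y) + A y - A (B f) = 0.
    by rewrite !BE /f scalerN; zmod.
  by rewrite nrm0.
have Bf : nrm (B f) <= c^-1.
  rewrite -[leRHS]mulr1 ler_pdivlMl//.
  by apply: le_trans (Ble _ (DB f)) _; rewrite BE nrmN ltW.
have sB : `|s| * nrm (B y) <= c^-1 + 1.
  rewrite -cmod_imag -nrmZ; have -> : Complex 0 s *: B y = B f - y.
    by rewrite -uE addrK.
  by apply: le_trans (nrmB _ _) _; rewrite lerD.
have s0 : 0 <= `|s| by [].
have := ler_wpM2l s0 mB.
have bm : ((1 + c^-1) / m + 1) * m <= `|s| * m by rewrite ler_pM2r.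
have mE : ((1 + c^-1) / m + 1) * m = 1 + c^-1 + m by field; rewrite !gt_eqF.
by rewrite mE in bm; lra.
Qed.

Context {T : R -> {linear H -> H}} (genT : generates A T) (dA : dissipative A).
Hypothesis contrT : forall (t : R) x, 0 <= t -> nrm (T t x) <= nrm x.

(** An approximate eigenvector for an imaginary frequency keeps its norm under
    the semigroup, up to the time-integrated residual. *)
Lemma sg_lower (s : R) y (t : R) : 0 <= t -> dom A y ->
  nrm y - t * nrm (Complex 0 s *: y - A y) <= nrm (T t y).
Proof.
rewrite le_eqVlt => /predU1P[<-|t0] Dy; first by rewrite (sg0 genT) mul0r subr0.
set f := _ *: y - A y.
apply: (@le_of_error _ _ _ t) => eta eta0 _.
have [d d0 dP] := sg_expand genT Dy eta0.
have [n nd] := small_step t d0; set h := t / n.+1%:R in nd.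
have h0 : 0 < h by rewrite divr_gt0.
have nh : n.+1%:R * h = t by rewrite /h mulrC divfK// pnatr_eq0.
have step k : nrm y - k%:R * h * (nrm f + eta) <= nrm (T (k%:R * h) y).
  elim: k => [|k ih]; first by rewrite !mul0r subr0 (sg0 genT).
  have kh0 : 0 <= k%:R * h by rewrite mulr_ge0// ltW.
  set u := T (k%:R * h) y in ih.
  pose r := T (k%:R * h) (T h y - y - h%:C%C *: A y).
  have rn : nrm r <= h * eta by apply: le_trans (contrT _ kh0) _; exact: dP.
  have fn : nrm (T (k%:R * h) f) <= nrm f by exact: contrT.
  have uE : (1 + h%:C%C * Complex 0 s) *: u =
      T (k.+1%:R * h) y - r + h%:C%C *: T (k%:R * h) f.
    rewrite /r /f !(linearB (T _)) !(linearZ_LR (T _)) /= -natr1 mulrDl mul1r.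
    rewrite (sgD genT _ kh0 (ltW h0)) -/u scalerDl scale1r -scalerA scalerBr.
    by zmod.
  have u1 : nrm u <= nrm ((1 + h%:C%C * Complex 0 s) *: u).
    rewrite nrmZ ler_peMl ?nrm_ge0//.
    apply: le_trans (Re_le_cmod _); rewrite /= mul0r mulr0 subr0 addr0.
    by rewrite normr1.
  have := nrmD (T (k.+1%:R * h) y - r) (h%:C%C *: T (k%:R * h) f).
  rewrite -uE nrmZR (gtr0_norm h0).
  have := nrmB (T (k.+1%:R * h) y) r.
  have := ler_wpM2l (ltW h0) fn.
  rewrite -[k.+1%:R]natr1 !mulrDl mul1r in ih *; lra.
have := step n.+1; rewrite nh; lra.
Qed.

Hypothesis surjA : forall a : R, 0 < a -> onto A a%:C%C.

Lemma norm_continuous_near (t : R) : 0 <= t ->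
  opnorm (fun x => T s x - T t x) @[s --> t] --> (0 : R) ->
  forall e : R, 0 < e -> exists2 d : R, 0 < d & forall r y, 0 <= r -> r <= d ->
    nrm y <= 1 -> nrm (T r (T t y) - T t y) <= e.
Proof.
move=> t0 /cvgrPdist_lt Tt e e0.
have := Tt e e0; rewrite near_simpl => /nbhs_ballP[d /= d0 dP].
exists (d / 2); first by rewrite divr_gt0.
move=> r y r0 rd y1; rewrite -(sgD genT)//.
have : ball t d (r + t).
  by rewrite -ball_normE /= opprD addrCA subrr addr0 normrN ger0_norm//; lra.
move=> /dP; rewrite sub0r normrN => /(le_lt_trans (ler_norm _)) /ltW.
apply: le_trans.
apply: (@nrm_le_opnorm _ _ _ (fun x => T (r + t) x - T t x) 2) => // x x1.
apply: le_trans (nrmB _ _) _.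
have := contrT x t0; have := contrT x (addr_ge0 r0 t0); lra.
Qed.

(** For an approximate eigenvector [y] of high frequency, [T t y] oscillates
    too fast to survive the averaging done by a resolvent, while norm
    continuity makes the resolvent act almost as the identity on the range of
    [T t]. *)
Lemma norm_continuous_high_frequency : eventually_norm_continuous T ->
  exists b : R, exists2 c : R, 0 < c &
    forall s, b <= `|s| -> lower_bound A (Complex 0 s) c.
Proof.
move=> [t0 t00 /(_ (t0 + 1))]; rewrite ltrDl ltr01 => /(_ isT) Tcont.
set t := t0 + 1 in Tcont.
have tgt0 : 0 < t by rewrite ltr_wpDl.
have e80 : 0 < 8^-1 :> R by rewrite invr_gt0.
have [d d0 dP] := norm_continuous_near (ltW tgt0) Tcont e80.
(* makes [2 / (1 + a * d)] at most [1 / 8] *)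
pose a := 16 / d; have a0 : 0 < a by rewrite divr_gt0.
exists (4 * (a + 1)); pose c := Num.min 1 (4 * t)^-1.
have c0 : 0 < c by rewrite lt_min ltr01 invr_gt0 mulr_gt0.
exists c => // s bs; apply: lower_bound_unit => y Dy y1.
rewrite leNgt; apply/negP; set f := _ - _ => fc.
have f1 : nrm f < 1 by apply: lt_le_trans fc _; rewrite ge_min lexx.
have tf : t * nrm f <= 4^-1.
  have : nrm f <= (4 * t)^-1.
    by apply: ltW; apply: lt_le_trans fc _; rewrite ge_min lexx orbT.
  by rewrite invfM ler_pdivlMr// mulrC.
pose z := T t y.
have z1 : nrm z <= 1 by rewrite -y1; apply: contrT; exact: ltW.
have zlow : 1 - t * nrm f <= nrm z by rewrite -{1}y1; apply: sg_lower => //; exact: ltW.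
have [p [Dp pE]] := surjA a0 (a%:C%C *: z).
have one0 : 0 <= 1 :> R by [].
have pz : nrm (p - z) <= 4^-1.
  have := @resolvent_close _ _ _ _ genT dA a d 1 8^-1 z p a0 d0 (ltW e80) one0.
  have H1 u w : 0 <= u -> u <= d -> nrm (T u w) <= 1 * nrm w.
    by move=> u0 _; rewrite mul1r; exact: contrT.
  have H2 u : 0 <= u -> u <= d -> nrm (T u z - z) <= 8^-1.
    by move=> u0 ud; apply: dP => //; rewrite y1.
  move=> /(_ H1 H2 Dp pE) /le_trans; apply.
  rewrite /a divfK ?gt_eqF//.
  have n17 : (1 + 1) * nrm z / (1 + 16) <= 8^-1 by rewrite ler_pdivrMr; lra.
  lra.
have [Dz Az] := sg_dom genT (ltW tgt0) Dy.
(* the resolvent at [a] applied to [T t f], written in terms of [p] *)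
pose q := a^-1%:C%C *: ((Complex 0 s - a%:C%C) *: p) + z.
have Dq : dom A q by apply: domD => //; do 2 apply: domZ.
have aC0 : a%:C%C != 0 :> R[i] by rewrite eq_complex /= eqxx andbT gt_eqF.
have qE : a%:C%C *: q - A q = T t f.
  rewrite /q opD//; last by do 2 apply: domZ.
  rewrite opZ; last exact: domZ.
  have aVK (v : H) : a^-1%:C%C *: (a%:C%C *: v) = v.
    by rewrite scalerA -rmorphM mulVf ?gt_eqF// scale1r.
  have aKV (v : H) : a%:C%C *: (a^-1%:C%C *: v) = v.
    by rewrite scalerA -rmorphM mulfV ?gt_eqF// scale1r.
  have ApE : A p = a%:C%C *: (p - z) by rewrite scalerBr -pE; zmod.
  have swap (v : H) : (Complex 0 s - a%:C%C) *: (a%:C%C *: v) =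
      a%:C%C *: ((Complex 0 s - a%:C%C) *: v) by rewrite !scalerA mulrC.
  rewrite opZ// scalerDr aKV ApE swap aVK Az /f.
  rewrite (linearB (T t)) (linearZ_LR (T t)) /= -/z !scalerBl !scalerBr.
  by zmod.
have qn : a * nrm q <= nrm f.
  apply: le_trans (contrT f (ltW tgt0)); rewrite -qE.
  exact: (dissipative_lower_bound a%:C%C dA).
have sp : `|s| * nrm p <= a * nrm q + a * nrm z.
  rewrite -mulrDr; apply: le_trans (_ : nrm ((Complex 0 s - a%:C%C) *: p) <= _).
    rewrite nrmZ ler_wpM2r ?nrm_ge0//.
    by apply: le_trans (Im_le_cmod _); rewrite /= subr0.
  have -> : (Complex 0 s - a%:C%C) *: p = a%:C%C *: (q - z).
    rewrite /q addrK scalerA -rmorphM mulfV ?gt_eqF// scale1r.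
    by [].
  by rewrite nrmZR (gtr0_norm a0) ler_wpM2l ?nrmB// ltW.
have p4 : nrm p <= 4^-1.
  have a10 : 0 < 4 * (a + 1) by lra.
  rewrite -(ler_pM2l a10); apply: le_trans (ler_wpM2r (nrm_ge0 p) bs) _.
  apply: le_trans sp _; have := ler_wpM2l (ltW a0) z1; lra.
have := nrm_le_sub z p; rewrite nrm_distC; lra.
Qed.

End HighFrequency.

(** * Feedback with compact embedding or split domain *)

Section SystemCases.
Context {R : realType} {H1 H2 : hilbertType R}.
Context {A1 : operator (hprod H1 H2) H1} {A21 : operator H1 H2}.
Context {S : {linear H2 -> H2}}.
Context (S_bounded : bounded_op S) {nu : R} (nu0 : 0 < nu).
Hypothesis S_coercive : forall g, nu * nrm g ^+ 2 <= rdot g (S g).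
Hypothesis dAext : dissipative (Aext A1 A21).
Hypothesis resAext : forall s : R, resolvent_set (Aext A1 A21) (Complex 0 s).
Local Notation AS := (AS A1 A21 S).

Lemma AS_compact_high_frequency : compactly_embedded_dom A21 ->
  exists b : R, exists2 c : R, 0 < c &
    forall s, b <= `|s| -> lower_bound AS (Complex 0 s) c.
Proof.
move=> Kc.
have [c c0] := AS_lower_bound S_bounded nu0 S_coercive dAext resAext 0.
rewrite (_ : Complex 0 0 = 0 :> R[i])// => lb.
have surj := AS_onto0 S_bounded nu0 S_coercive dAext resAext.
have [b bP] := compact_high_frequency c0 lb surj Kc.
pose k := Num.min 1 nu.
have k0 : 0 < k by rewrite lt_min ltr01.
exists b; exists k => // s bs; apply: lower_bound_unit => y Dy y1.
rewrite leNgt; apply/negP; set f := _ - _ => fk.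
have f1 : nrm f < 1 by apply: lt_le_trans fk _; rewrite ge_min lexx.
have A21y : nrm (A21 y) ^+ 2 <= 1.
  have := AS_A21_bound S_coercive dAext s Dy; rewrite -/f y1 mulr1 => gf.
  rewrite -(ler_pM2l nu0) mulr1; apply: le_trans gf _; apply: ltW.
  by apply: lt_le_trans fk _; rewrite ge_min lexx orbT.
(* halving [y] brings it into the unit ball of the graph norm *)
pose y' := 2^-1%:C%C *: y.
have y'n : nrm y' = 2^-1 by rewrite nrmZR y1 mulr1 ger0_norm.
have D21 : dom A21 y by case: Dy.
have Ky : dom A21 y' /\ graph_norm A21 y' <= 1.
  split; first exact: domZ.
  rewrite /graph_norm -[1]sqrtC1 ler_sqrtC ?nnegrE ?addr_ge0 ?exprn_ge0//.
  rewrite !normE y'n opZ// nrmZR [`|_|]ger0_norm//.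
  rewrite -!rmorphXn -rmorphD /= -[leRHS]/(1%:C%C) lecR exprMn.
  have -> : 2^-1 ^+ 2 = 4^-1 :> R by rewrite exprVn -natrX.
  lra.
have Dy' : dom AS y' by exact: domZ.
have e1 : 4^-1 <= 2^-1 :> R by lra.
have e2 : 2^-1 <= 1 :> R by lra.
have := bP s y' bs Dy' Ky; rewrite y'n => /(_ e1 e2).
have -> : Complex 0 s *: y' - AS y' = 2^-1%:C%C *: f.
  by rewrite /y' opZ// scalerBr !scalerA mulrC.
by rewrite nrmZR ger0_norm//; lra.
Qed.

(** In the split case dissipativity of the extended operator forces the
    off-diagonal parts to be formally skew-adjoint: [h2] may be scaled freely
    in the energy inequality, so the terms linear in it cancel. *)
Lemma split_skew (A11 : operator H1 H1) (A12 : operator H2 H1) h1 h2 :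
  row_split A1 A11 A12 -> dom A11 h1 -> dom A21 h1 -> dom A12 h2 ->
  rdot (A12 h2) h1 = - rdot (A21 h1) h2.
Proof.
move=> [splitD splitE] D11 D21 D12.
pose k := rdot (A12 h2) h1 + rdot (A21 h1) h2.
have ineq r : rdot (A11 h1) h1 + r * k <= 0.
  have D12r : dom A12 (r%:C%C *: h2) by exact: domZ.
  have Dx : dom (Aext A1 A21) (h1, r%:C%C *: h2) by split => //=; apply/splitD.
  have := dAext Dx; rewrite prod_rdot /= splitE// opZ// rdotDl rdotZl rdotZr.
  by rewrite /k; lra.
suff : k = 0 by rewrite /k; lra.
apply/eqP/negPn/negP => k0; have := ineq ((1 - rdot (A11 h1) h1) / k).
by rewrite divfK//; lra.
Qed.

Lemma split_offdiagonal (A11 : operator H1 H1) (A12 : operator H2 H1) h1 h2 :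
  row_split A1 A11 A12 -> dom A11 h1 -> dom A21 h1 -> dom A12 h2 ->
  cmod '[h1, A12 h2] <= 2 * (nrm (A21 h1) * nrm h2).
Proof.
move=> sp D11 D21 D12.
have rl g : dom A12 g -> `|rdot (A12 g) h1| <= nrm (A21 h1) * nrm g.
  by move=> Dg; rewrite (split_skew sp)// normrN ler_norml rdot_ge rdot_le.
apply: le_trans (cmod_le_ReIm _) _.
have e1 : `|complex.Re '[h1, A12 h2]| <= nrm (A21 h1) * nrm h2.
  by rewrite -/(rdot _ _) rdotC rl.
(* the imaginary part is, up to sign, the real part for [i h2] *)
have e2 : `|complex.Im '[h1, A12 h2]| <= nrm (A21 h1) * nrm h2.
  have := rl (Complex 0 1 *: h2) (domZ _ D12).
  rewrite opZ// nrmZ cmod_imag normr1 mul1r rdotC /rdot hdotZr.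
  by case: '[h1, _] => p q /=; rewrite mul0r sub0r mulN1r opprK.
lra.
Qed.

Lemma AS_split_high_frequency : split_bounded_range A1 ->
  exists b : R, exists2 c : R, 0 < c &
    forall s, b <= `|s| -> lower_bound AS (Complex 0 s) c.
Proof.
move=> [A11 [A12 [sp [eps eps0 [M [Mreal MP]]]]]].
have [C C0 SC] := bounded_opP S_bounded.
pose K := 1 + 2 * (C / nu).
have K1 : 1 <= K by rewrite lerDl mulr_ge0// divr_ge0// ltW.
have K0 : 0 < K by exact: lt_le_trans K1.
pose c := eps / K; have c0 : 0 < c by rewrite divr_gt0.
have MP' q : (numerical_range A11 `&` strip eps) q -> cmod q <= complex.Re M + 1.
  move=> /MP; have ME : M = (complex.Re M)%:C%C by rewrite RRe_real.
  move=> /(_ (complex.Re M + 1)%:C%C); rewrite {1}ME ltcR ltrDl ltr01.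
  by move=> /(_ isT) qle; rewrite -lecR -cnormE.
exists (complex.Re M + 1 + eps + 1); exists c => // s bs.
apply: lower_bound_unit => v Dv v1; rewrite leNgt; apply/negP.
set f := _ - _ => fc.
have [D21 D1] := Dv; have /(sp.1 _ _)[D11 D12] := D1.
have gb : nrm (A21 v) ^+ 2 <= c / nu.
  rewrite ler_pdivlMr// mulrC.
  apply: le_trans (AS_A21_bound S_coercive dAext s Dv) _.
  by rewrite v1 mulr1 ltW.
set e := '[v, A12 (S (A21 v))].
have eb : cmod e <= 2 * (C * (c / nu)).
  apply: le_trans (split_offdiagonal sp D11 D21 D12) _.
  rewrite ler_pM2l//; apply: le_trans (ler_wpM2l (nrm_ge0 _) (SC _)) _.
  by rewrite mulrCA -expr2 ler_wpM2l.
have vf : cmod '[v, f] <= c.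
  by apply: le_trans (hdot_le _ _) _; rewrite v1 mul1r ltW.
have ASv : AS v = A11 v + A12 (S (A21 v)) by exact: sp.2.
have qE : '[v, A11 v] = Complex 0 (- s) - '[v, f] - e.
  have -> : A11 v = Complex 0 s *: v - f - A12 (S (A21 v)).
    by rewrite /f ASv; zmod.
  rewrite !linearBr /= hdotZr hdot_norm normE v1.
  by rewrite expr1n mulr1 /=.
set q := '[v, A11 v] in qE.
have ceE : c + 2 * (C * (c / nu)) = eps.
  have -> : c + 2 * (C * (c / nu)) = c * K by rewrite /K; field; rewrite gt_eqF.
  by rewrite /c divfK// gt_eqF.
have qR0 : complex.Re q <= 0.
  have D0 : dom A12 0 by exact: dom0.
  have Dx : dom (Aext A1 A21) (v, 0) by split => //=; apply/(sp.1 _ _).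
  have := dAext Dx; rewrite prod_rdot /= (sp.2 _ _ D11 D0) op0 addr0.
  by rewrite [rdot _ 0]/rdot linear0r /= addr0 rdotC.
have /MP' qM : (numerical_range A11 `&` strip eps) q.
  split; first by exists v => //; split => //; rewrite normE v1.
  rewrite /strip /= qR0 andbT qE.
  have := Re_le_cmod '[v, f]; have := Re_le_cmod e; rewrite !ler_norml.
  case: '[v, f] vf => p1 p2; case: (e) eb => p3 p4 /= *; lra.
have := le_trans (Im_le_cmod q) qM; rewrite qE.
have := Im_le_cmod '[v, f]; have := Im_le_cmod e; rewrite !ler_norml.
case: '[v, f] vf => p1 p2; case: (e) eb => p3 p4 /=.
move=> *; have : `|s| <= complex.Re M + 1 + eps; last by lra.
by rewrite ler_norml; lra.
Qed.

End SystemCases.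

(** * Positive semigroups *)

Section Positive.
Context {R : realType} {H : hilbertType R} {A : operator H H}.
Context {T : R -> {linear H -> H}} (genT : generates A T).
Hypothesis contrT : forall (t : R) x, 0 <= t -> nrm (T t x) <= nrm x.

(** The resolvent is the Laplace transform of the semigroup, so an orbit
    dominated by another one has its resolvent at [a + i s] dominated by the
    other one's at [a].  The Laplace transform enters through its
    discretization [discrete_laplace]. *)
Lemma resolvent_domination (a s : R) y f g Y F G : 0 < a ->
  dom A y -> Complex a s *: y - A y = f ->
  dom A Y -> a%:C%C *: Y - A Y = F ->
  (forall t, 0 <= t -> cmod '[T t f, g] <= rdot (T t F) G) ->
  cmod '[y, g] <= rdot Y G.
Proof.
move=> a0 Dy fE DY FE dom_fF.
pose E := nrm y * nrm g + nrm Y * nrm G + (nrm g + nrm G) / a.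
apply: (@le_of_error _ _ _ E) => eta eta0 _.
have [d1 d10 d1P] := sg_expand genT Dy eta0.
have [d2 d20 d2P] := sg_expand genT DY eta0.
have min0 : 0 < Num.min d1 d2 by rewrite lt_min d10.
have [n] := small_step 1 min0; set h := 1 / n.+1%:R.
rewrite lt_min => /andP[hd1 hd2].
have h0 : 0 < h by rewrite divr_gt0.
clearbody h.
pose m := 1 + a * h; have m1 : 1 < m by rewrite ltrDl mulr_gt0.
have m0 : 0 < m by exact: lt_trans m1.
pose mu : R[i] := 1 + h%:C%C * Complex a s.
have mmu : m <= cmod mu.
  apply: le_trans (Re_le_cmod _); apply: le_trans (ler_norm _).
  by rewrite /mu /= mul0r subr0 /m mulrC.
have mu0 : mu != 0.
  by apply: contraTneq (lt_le_trans m0 mmu) => ->; rewrite /cmod normr0 ltxx.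
have mC0 : m%:C%C != 0 :> R[i] by rewrite eq_complex /= eqxx andbT gt_eqF.
pose r := T h y - y - h%:C%C *: A y.
pose r' := T h Y - Y - h%:C%C *: A Y.
have rn : nrm r <= h * eta by exact: d1P.
have r'n : nrm r' <= h * eta by exact: d2P.
have yE : mu *: y = T h y + (h%:C%C *: f - r).
  by rewrite /r -fE /mu scalerDl scale1r -scalerA scalerBr; zmod.
have YE : m%:C%C *: Y = T h Y + (h%:C%C *: F - r').
  rewrite /r' -FE /m rmorphD rmorphM /= [a%:C%C * _]mulrC.
  by rewrite scalerDl scale1r -scalerA scalerBr; zmod.
clearbody r r'.
have [K Keta] : exists K : nat, m ^- K <= eta.
  have [k kh] := small_step eta^-1 (mulr_gt0 a0 h0).
  exists k.+1; rewrite -[leRHS]invrK lef_pV2 ?posrE ?exprn_gt0 ?invr_gt0//.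
  have := @bernoulli_ge R (a * h) k.+1 (mulr_ge0 (ltW a0) (ltW h0)).
  move: kh; rewrite ltr_pdivrMr// [_ * k.+1%:R]mulrC => kh.
  by apply: le_trans; rewrite -[leLHS]add0r lerD// ltW.
have kh0 (k : nat) : 0 <= k%:R * h by rewrite mulr_ge0// ltW.
have mk k : 0 <= m ^- k by rewrite invr_ge0 exprn_ge0// ltW.
have muk k : cmod (mu ^- k) <= m ^- k.
  rewrite cmodV cmodX lef_pV2 ?posrE ?exprn_gt0 ?(lt_le_trans m0)//.
  by rewrite lerXn2r ?nnegrE ?cmod_ge0 ?(ltW m0).
have mE k : m%:C%C ^- k = (m ^- k)%:C%C :> R[i] by rewrite fmorphV rmorphXn.
pose I k := rdot (T (k%:R * h) F) G.
pose sum_I := \sum_(k < K) m ^- k.+1 * (h * I k).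
pose sum_m := \sum_(k < K) m ^- k.+1 * h.
have sum_mle : sum_m <= a^-1.
  have sumE : sum_m * a = 1 - m ^- K.
    rewrite -(sum_geometric K m1) mulr_suml; apply: eq_bigr => k _.
    by rewrite -mulrA; congr (_ * _); rewrite /m addrAC subrr add0r mulrC.
  by rewrite -(ler_pM2r a0) mulVf ?gt_eqF// sumE lerBlDr lerDl.
have up : cmod '[y, g] <= m ^- K * (nrm y * nrm g) + sum_I + sum_m * eta * nrm g.
  rewrite {1}(discrete_laplace genT K mu0 (ltW h0) yE).
  rewrite linearDl /= hdotZl linear_sumlz /= -addrA.
  apply: le_trans (cmodD _ _) _; apply: lerD.
    rewrite cmodM; apply: ler_pM; rewrite ?cmod_ge0//.
    apply: le_trans (hdot_le _ _) _; apply: ler_wpM2r; first exact: nrm_ge0.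
    exact: contrT.
  apply: le_trans (cmod_sum _ _ _) _.
  rewrite /sum_I /sum_m 2!mulr_suml -big_split /=; apply: ler_sum => k _.
  rewrite hdotZl cmodM -!mulrA -mulrDr; apply: ler_pM; rewrite ?cmod_ge0//.
  rewrite (linearB (T _)) (linearZ_LR (T _)) /= linearBl /= hdotZl.
  apply: le_trans (cmodD _ _) _; rewrite cmodN cmodM cmodR (gtr0_norm h0).
  apply: lerD; first by rewrite ler_pM2l// dom_fF.
  apply: le_trans (hdot_le _ _) _; rewrite mulrA; apply: ler_wpM2r.
    exact: nrm_ge0.
  exact: le_trans (contrT _ (kh0 k)) rn.
have lo : sum_I <= rdot Y G + m ^- K * (nrm Y * nrm G) + sum_m * eta * nrm G.
  have := congr1 (fun z => rdot z G) (discrete_laplace genT K mC0 (ltW h0) YE).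
  rewrite /= rdotDl mE rdotZl => ->.
  have -> : rdot (\sum_(k < K) m%:C%C ^- k.+1 *:
        T (k%:R * h) (h%:C%C *: F - r')) G =
      \sum_(k < K) m ^- k.+1 * (h * I k - rdot (T (k%:R * h) r') G).
    rewrite /rdot linear_sumlz /= raddf_sum /=; apply: eq_bigr => k _.
    rewrite -/(rdot _ _) mE rdotZl (linearB (T _)) (linearZ_LR (T _)) /=.
    by rewrite rdotDl rdotNl rdotZl.
  have e1 : - (m ^- K * (nrm Y * nrm G)) <= m ^- K * rdot (T (K%:R * h) Y) G.
    rewrite -mulrN ler_wpM2l//; apply: le_trans (rdot_ge _ _).
    by rewrite lerN2 ler_wpM2r ?nrm_ge0// contrT.
  have e2 : sum_I <= \sum_(k < K) m ^- k.+1 * (h * I k - rdot (T (k%:R * h) r') G) +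
      sum_m * eta * nrm G.
    rewrite /sum_I /sum_m 2!mulr_suml -big_split /=; apply: ler_sum => k _.
    rewrite -!mulrA -mulrDr; apply: ler_wpM2l => //.
    rewrite -addrA lerDl addrC subr_ge0; apply: le_trans (rdot_le _ _) _.
    rewrite mulrA; apply: ler_wpM2r; first exact: nrm_ge0.
    exact: le_trans (contrT _ (kh0 k)) r'n.
  lra.
have gn := nrm_ge0 g; have Gn := nrm_ge0 G.
have e1 : m ^- K * (nrm y * nrm g) <= eta * (nrm y * nrm g).
  by rewrite ler_wpM2r// mulr_ge0 ?nrm_ge0.
have e2 : m ^- K * (nrm Y * nrm G) <= eta * (nrm Y * nrm G).
  by rewrite ler_wpM2r// mulr_ge0 ?nrm_ge0.
have e3 := ler_wpM2r (mulr_ge0 (ltW eta0) gn) sum_mle.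
have e4 := ler_wpM2r (mulr_ge0 (ltW eta0) Gn) sum_mle.
rewrite /E; lra.
Qed.

End Positive.

Section Cone.
Context {R : realType} {H : hilbertType R} {A : operator H H}.
Context {T : R -> {linear H -> H}} (genT : generates A T).
Hypothesis contrT : forall (t : R) x, 0 <= t -> nrm (T t x) <= nrm x.
Context (P : set H).
Hypothesis P_split : forall h, exists p : 'I_4 -> H,
  h = \sum_(j < 4) Complex 0 1 ^+ j *: p j /\
  forall j, P (p j) /\ nrm (p j) <= nrm h.
Hypothesis P_dot : forall p q, P p -> P q -> 0 <= '[p, q].
Hypothesis P_inv : forall (t : R) p, 0 <= t -> P p -> P (T t p).

(** Splitting [f] and [g] into four elements of the cone each, the pairing is a
    sum of sixteen terms, the moduli of which are pairings of cone elements. *)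
Lemma cone_domination f g : exists F G : H,
  [/\ nrm F <= 4 * nrm f, nrm G <= 4 * nrm g &
  forall t, 0 <= t -> cmod '[T t f, g] <= rdot (T t F) G].
Proof.
have [p [pE pP]] := P_split f; have [q [qE qP]] := P_split g.
have sum4 h (r : 'I_4 -> H) : (forall j, P (r j) /\ nrm (r j) <= nrm h) ->
    nrm (\sum_(j < 4) r j) <= 4 * nrm (h : H).
  move=> rP; apply: le_trans (nrm_sum _ _ _) _.
  apply: le_trans (_ : \sum_(j < 4) nrm h <= _).
    by apply: ler_sum => j _; have [] := rP j.
  by rewrite sumr_const card_ord mulr_natl.
exists (\sum_j p j), (\sum_j q j); split; [exact: sum4|exact: sum4|] => t t0.
have i1 k : cmod (Complex 0 1 ^+ k : R[i]) = 1.
  by rewrite cmodX cmod_imag normr1 expr1n.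
rewrite pE qE !(linear_sum (T t)) /rdot !linear_sumlz /= raddf_sum /=.
apply: le_trans (cmod_sum _ _ _) _.
apply: ler_sum => j _; rewrite (linearZ_LR (T t)) /= hdotZl cmodM i1 mul1r.
rewrite !linear_sumr /= raddf_sum /=.
apply: le_trans (cmod_sum _ _ _) _; apply: ler_sum => k _.
rewrite hdotZr cmodM.
have -> : cmod ((Complex 0 1 ^+ k)^*)%C = 1 :> R.
  by rewrite /cmod normcJ -/(cmod _) i1.
have [Pp _] := pP j; have [Pq _] := qP k.
have pq0 := P_dot (P_inv t0 Pp) Pq.
by rewrite mul1r /cmod ger0_norm.
Qed.

(** The bound survives the limit of [a] tending to zero because the resolvent
    at [a] stays bounded near the resolvent point zero. *)
Lemma cone_lower_bound (c : R) : 0 < c -> lower_bound A 0 c ->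
  (forall a : R, 0 < a -> onto A a%:C%C) ->
  forall s, lower_bound A (Complex 0 s) (c / 32).
Proof.
move=> c0 lb surj s; apply: lower_bound_unit => y Dy y1.
apply: (@le_of_error _ _ _ 1) => eta eta0 _; rewrite mul1r.
pose a := Num.min eta (c / 2).
have a0 : 0 < a by rewrite lt_min eta0 divr_gt0.
have ac : a <= c / 2 by rewrite ge_min lexx orbT.
have aeta : a <= eta by rewrite ge_min lexx.
set f := Complex a s *: y - A y.
have [F [G [Fn Gn FG]]] := cone_domination f y.
have [Y [DY YE]] := surj a a0 F.
have := resolvent_domination genT contrT a0 Dy (erefl : _ = f) DY YE FG.
rewrite hdot_norm normE y1 expr1n.
have -> : cmod (1 : R[i]) = 1 by rewrite /cmod normr1.
move=> YG.
have Yn : c / 2 * nrm Y <= nrm F.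
  have := lower_bound_shift a%:C%C lb DY; rewrite YE subr0 cmodR (gtr0_norm a0).
  by apply: le_trans; rewrite ler_wpM2r ?nrm_ge0//; lra.
have Yn0 := nrm_ge0 Y.
have G4 : nrm G <= 4 by rewrite y1 mulr1 in Gn.
have Y4 : 1 <= 4 * nrm Y.
  apply: le_trans YG _; apply: le_trans (rdot_le _ _) _.
  by rewrite mulrC ler_wpM2r.
have ff : nrm f <= nrm (Complex 0 s *: y - A y) + a.
  have -> : f = (Complex 0 s *: y - A y) + a%:C%C *: y.
    have -> : f = (Complex 0 s + a%:C%C) *: y - A y.
      rewrite /f; congr (_ *: _ - _).
      by apply/eqP; rewrite eq_complex /= add0r addr0 !eqxx.
    by rewrite scalerDl; zmod.
  by apply: le_trans (nrmD _ _) _; rewrite nrmZR y1 mulr1 (gtr0_norm a0).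
have c20 : 0 < c / 2 by rewrite divr_gt0.
have := ler_wpM2l (ltW c20) Y4; lra.
Qed.

End Cone.

(** * The cone of nonnegative square-integrable functions *)

Section L2Cone.
Context {R : realType} {d : measure_display} {Om : measurableType d}.
Context {mu : {measure set Om -> \bar R}} {H : hilbertType R}.
Context {cls : (Om -> R[i]) -> H} (L2 : is_L2 mu cls).
Implicit Types f g : Om -> R[i].

Lemma Re_norm_sqr (z : R[i]) : complex.Re (`|z| ^+ 2) = cmod z ^+ 2.
Proof. by rewrite cnormE -rmorphXn. Qed.

Lemma cmeasurable_cmod_sqr f : cmeasurable f ->
  measurable_fun setT (EFin \o (fun w => cmod (f w) ^+ 2)).
Proof.
move=> [mr mi]; apply/measurable_EFinP.
under eq_fun do rewrite cmod_sqr.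
by apply: measurable_funD; exact: measurable_funX.
Qed.

Lemma L2fun_dominated f g : cmeasurable g -> (forall w, cmod (g w) <= cmod (f w)) ->
  L2fun mu f -> L2fun mu g.
Proof.
move=> mg gf [mf fi]; split => //; apply: le_lt_trans fi.
under eq_integral do rewrite Re_norm_sqr.
under [leRHS]eq_integral do rewrite Re_norm_sqr.
apply: ge0_le_integral => //.
- by move=> w _; rewrite lee_fin sqr_ge0.
- exact: cmeasurable_cmod_sqr.
- exact: cmeasurable_cmod_sqr.
- by move=> w _; rewrite lee_fin ler_sqr ?nnegrE ?cmod_ge0.
Qed.

Lemma L2_nrm_sqr f : L2fun mu f ->
  ((nrm (cls f) ^+ 2)%:E = \int[mu]_w (cmod (f w) ^+ 2)%:E)%E.
Proof.
move=> L2f; have [_ /(_ f f L2f L2f) dotE _] := L2.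
rewrite -rdotxx /rdot dotE /= /Rintegral.
have E : (fun w => (complex.Re (f w * (f w)^*))%:E) = (fun w => (cmod (f w) ^+ 2)%:E).
  by apply/funext => w; rewrite -normCK Re_norm_sqr.
rewrite E fineK// ge0_fin_numE; last first.
  by apply: integral_ge0 => w _; rewrite lee_fin sqr_ge0.
case: L2f => _; under eq_integral do rewrite Re_norm_sqr.
by [].
Qed.

Lemma L2_nrm_le f g : L2fun mu f -> L2fun mu g ->
  (forall w, cmod (g w) <= cmod (f w)) -> nrm (cls g) <= nrm (cls f).
Proof.
move=> L2f L2g gf; rewrite -ler_sqr ?nnegrE ?nrm_ge0// -lee_fin !L2_nrm_sqr//.
case: L2f L2g => mf _ [mg _].
apply: ge0_le_integral => //.
- by move=> w _; rewrite lee_fin sqr_ge0.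
- exact: cmeasurable_cmod_sqr.
- exact: cmeasurable_cmod_sqr.
- by move=> w _; rewrite lee_fin ler_sqr ?nnegrE ?cmod_ge0.
Qed.

Lemma nonneg_class_dot h1 h2 : nonneg_class mu cls h1 ->
  nonneg_class mu cls h2 -> 0 <= '[h1, h2].
Proof.
move=> [f [L2f <- f0]] [g [L2g <- g0]].
have [_ /(_ f g L2f L2g) -> _] := L2.
have [[mfr mfi] _] := L2f; have [[mgr mgi] _] := L2g.
have reE w : complex.Re (f w * (g w)^*) =
    complex.Re (f w) * complex.Re (g w) + complex.Im (f w) * complex.Im (g w).
  by case: (f w) => a b; case: (g w) => p q /=; ring.
have imE w : complex.Im (f w * (g w)^*) =
    complex.Im (f w) * complex.Re (g w) - complex.Re (f w) * complex.Im (g w).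
  by case: (f w) => a b; case: (g w) => p q /=; ring.
have mre : measurable_fun setT (fun w => complex.Re (f w * (g w)^*)).
  by under eq_fun do rewrite reE; apply: measurable_funD; exact: measurable_funM.
have mim : measurable_fun setT (fun w => complex.Im (f w * (g w)^*)).
  by under eq_fun do rewrite imE; apply: measurable_funB; exact: measurable_funM.
have fg0 : {ae mu, forall w, 0 <= f w * (g w)^*}.
  apply: filterS2 f0 g0 => w fw gw; rewrite mulr_ge0//.
  by rewrite Num.Theory.conjC_ge0.
rewrite lecE /=; apply/andP; split.
  rewrite /Rintegral (ae_eq_integral (cst 0%E))//= ?integral0//.
    exact/measurable_EFinP.
  by apply: filterS fg0 => w + _; rewrite lecE /= => /andP[/eqP-> _].
rewrite /Rintegral fine_ge0//.
rewrite (ae_eq_integral (fun w => (Num.max (complex.Re (f w * (g w)^*)) 0)%:E))//=.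
- by apply: integral_ge0 => w _; rewrite lee_fin le_max lexx orbT.
- exact/measurable_EFinP.
- by apply/measurable_EFinP; apply: measurable_maxr.
apply: filterS fg0 => w + _; rewrite lecE /= => /andP[_ r0].
by congr EFin; apply/esym/max_idPl.
Qed.

Lemma nonneg_class_split h : exists p : 'I_4 -> H,
  h = \sum_(j < 4) Complex 0 1 ^+ j *: p j /\
  forall j, nonneg_class mu cls (p j) /\ nrm (p j) <= nrm h.
Proof.
have [clsP _ /(_ h)[f L2f <-]] := L2.
have [[mr mi] _] := L2f.
(* every part of [f] below is a real function dominated by [f] *)
have part (r : Om -> R) : measurable_fun setT r ->
    (forall w, `|r w| <= cmod (f w)) -> L2fun mu (fun w => (r w)%:C%C).
  move=> mfr rf; apply: L2fun_dominated L2f => [|w]; last by rewrite cmodR.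
  by split => //=; exact: measurable_cst.
have Ref w : `|complex.Re (f w)| <= cmod (f w) by exact: Re_le_cmod.
have Imf w : `|complex.Im (f w)| <= cmod (f w) by exact: Im_le_cmod.
pose pos (r : Om -> R) w := Num.max (r w) 0.
have posP (r : Om -> R) : measurable_fun setT r ->
    (forall w, `|r w| <= cmod (f w)) -> L2fun mu (fun w => (pos r w)%:C%C) /\
    nonneg_class mu cls (cls (fun w => (pos r w)%:C%C)) /\
    nrm (cls (fun w => (pos r w)%:C%C)) <= nrm (cls f).
  move=> mfr rf.
  have pr w : `|pos r w| <= cmod (f w).
    rewrite /pos ger0_norm ?le_max ?lexx ?orbT//.
    rewrite ge_max cmod_ge0 andbT; apply: le_trans (rf w); exact: ler_norm.
  have L2p : L2fun mu (fun w => (pos r w)%:C%C).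
    by apply: part => //; apply: measurable_maxr.
  split => //; split; last by apply: L2_nrm_le => // w; rewrite cmodR.
  exists (fun w => (pos r w)%:C%C); split => //.
  by apply: aeW => w; rewrite lecR /pos le_max lexx orbT.
pose neg (r : Om -> R) := pos (fun w => - r w).
have negP (r : Om -> R) : measurable_fun setT r ->
    (forall w, `|r w| <= cmod (f w)) -> L2fun mu (fun w => (neg r w)%:C%C) /\
    nonneg_class mu cls (cls (fun w => (neg r w)%:C%C)) /\
    nrm (cls (fun w => (neg r w)%:C%C)) <= nrm (cls f).
  move=> mfr rf; apply: posP; first exact: measurable_funN.
  by move=> w; rewrite normrN.
have decomp (r : Om -> R) : measurable_fun setT r ->
    (forall w, `|r w| <= cmod (f w)) ->
    cls (fun w => (r w)%:C%C) =
      cls (fun w => (pos r w)%:C%C) - cls (fun w => (neg r w)%:C%C).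
  move=> mfr rf; have [Lp _] := posP r mfr rf; have [Ln _] := negP r mfr rf.
  rewrite addrC -scaleN1r -clsP//; congr cls; apply/funext => w.
  rewrite mulN1r -rmorphN -rmorphD /=; congr (_%:C%C).
  rewrite /neg /pos; have [r0|r0] := leP (r w) 0.
    by rewrite addr0 max_l ?oppr_ge0// opprK.
  by rewrite max_r ?oppr_le0 ?ltW// oppr0 add0r.
(* the order matches the powers [1], [i], [-1], [-i] *)
exists (fun j => nth 0 [:: cls (fun w => (pos (fun w => complex.Re (f w)) w)%:C%C);
  cls (fun w => (pos (fun w => complex.Im (f w)) w)%:C%C);
  cls (fun w => (neg (fun w => complex.Re (f w)) w)%:C%C);
  cls (fun w => (neg (fun w => complex.Im (f w)) w)%:C%C)] j); split; last first.
  by case=> -[|[|[|[|//]]]] /= _; [case: (posP _ mr Ref)|case: (posP _ mi Imf)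
    |case: (negP _ mr Ref)|case: (negP _ mi Imf)].
rewrite !big_ord_recl big_ord0 addr0 /= /bump /= !addn0 !addn1 expr0 scale1r.
have i2 : Complex 0 1 ^+ 2 = -1 :> R[i] by exact: sqr_i.
have -> : Complex 0 1 ^+ 3 = - Complex 0 1 :> R[i] by rewrite exprS i2 mulrN1.
rewrite i2 expr1 scaleN1r scaleNr.
have fE : f = fun w => Complex 0 1 * (complex.Im (f w))%:C%C + (complex.Re (f w))%:C%C.
  apply/funext => w; case: (f w) => p q; apply/eqP; rewrite eq_complex /=.
  by apply/andP; split; apply/eqP; ring.
rewrite {1}fE clsP; [|exact: part|exact: part].
rewrite (decomp _ mr Ref) (decomp _ mi Imf) scalerBr.
by zmod.
Qed.

End L2Cone.

(** * Exponential stability *)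

Theorem theorem3p12 (R : realType) (H1 H2 : hilbertType R)
    (H1_neq0 : exists h : H1, h != 0) (H2_neq0 : exists h : H2, h != 0)
    (A1 : operator (hprod H1 H2) H1) (A21 : operator H1 H2)
    (S : {linear H2 -> H2}) (S_bounded : bounded_op S) (S_coercive : coercive S)
    (Aext_gen : generates_contractive_C0_semigroup (Aext A1 A21))
    (Aext_spec : spectrum (Aext A1 A21) `&` imaginary_axis = set0)
    (T : R -> {linear H1 -> H1}) (AS_gen : generates (AS A1 A21 S) T) :
  [/\ compactly_embedded_dom A21 -> exponentially_stable T,
      eventually_norm_continuous T -> exponentially_stable T,
      split_bounded_range A1 -> exponentially_stable T &
      positive_on_L2 T -> exponentially_stable T].
Proof.
have [nu nu0 S_nu] := S_coercive.
have S_energy g : nu * nrm g ^+ 2 <= rdot g (S g).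
  by have := S_nu g; rewrite normE -rmorphXn.
have dAext : dissipative (Aext A1 A21).
  by have [T' genT' contrT'] := Aext_gen; exact: contractive_dissipative contrT'.
have resAext (s : R) : resolvent_set (Aext A1 A21) (Complex 0 s).
  apply: contrapT => ns.
  by have : (spectrum (Aext A1 A21) `&` imaginary_axis) (Complex 0 s);
    [split|rewrite Aext_spec].
have surj (a : R) : 0 < a -> onto (AS A1 A21 S) a%:C%C.
  by move=> a0; apply: (AS_onto S_bounded nu0 S_energy dAext resAext); exact: ltW.
have dAS := AS_dissipative nu0 S_energy dAext.
have contrT (t : R) x : 0 <= t -> nrm (T t x) <= nrm x.
  exact: (AS_contractive S_bounded nu0 S_energy dAext resAext AS_gen).
have stable (b c : R) : 0 < c ->
    (forall s, b <= `|s| -> lower_bound (AS A1 A21 S) (Complex 0 s) c) ->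
    exponentially_stable T.
  exact: (high_frequency_stable S_bounded nu0 S_energy dAext resAext AS_gen).
split.
- move=> /(AS_compact_high_frequency S_bounded nu0 S_energy dAext resAext).
  by move=> [b [c c0 hi]]; exact: stable c0 hi.
- move=> /(norm_continuous_high_frequency AS_gen dAS contrT surj).
  by move=> [b [c c0 hi]]; exact: stable c0 hi.
- move=> /(AS_split_high_frequency S_bounded nu0 S_energy dAext).
  by move=> [b [c c0 hi]]; exact: stable c0 hi.
move=> [d [Om [mu [cls [L2 posT]]]]].
have [c c0 lb] := AS_lower_bound S_bounded nu0 S_energy dAext resAext 0.
have c32 : 0 < c / 32 by rewrite divr_gt0.
apply: (stable 0 _ c32) => s _.
exact: (cone_lower_bound AS_gen contrT (nonneg_class_split L2)
  (nonneg_class_dot L2) posT c0 lb surj).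
Qed.
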